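(* There exist uncountably many RGD systems which are not linearizable.
   Context: **Roots as half-spaces.** Let $(W,S)$ be a Coxeter system with length function $\ell$; $m_{st}$ denotes the order of $st$ in $W$. For $s\in S$ put $\alpha_s=\{w\in W\mid \ell(sw)>\ell(w)\}$. A root is a translate $w\alpha_s$ ($w\in W$, $s\in S$); $\Phi(W,S)$ is the set of roots, on which $W$ acts by left translation. A root is positive if it contains $1_W$, and negative otherwise; $\Phi(W,S)_{\pm}$ are the sets of positive/negative roots. For a root $\alpha$ put $-\alpha:=W\setminus\alpha\in\Phi(W,S)$. A pair $\{\alpha,\beta\}\subseteq\Phi(W,S)$ is prenilpotent if there are $w,w'\in W$ with $\{w\alpha,w\beta\}\subseteq\Phi(W,S)_+$ and $\{w'\alpha,w'\beta\}\subseteq\Phi(W,S)_-$. In this case $[\alpha,\beta]$ is the set of all $\gamma\in\Phi(W,S)$ such that for all $w\in W$ and $\epsilon\in\{+,-\}$: $\{w\alpha,w\beta\}\subseteq\Phi(W,S)_\epsilon$ implies $w\gamma\in\Phi(W,S)_\epsilon$; and $(\alpha,\beta):=[\alpha,\beta]\setminus\{\alpha,\beta\}$. **RGD systems.** An RGD system of type $(W,S)$ is a pair $\mathcal D=(G,(U_\alpha)_{\alpha\in\Phi(W,S)})$ of a group $G$ and subgroups $U_\alpha\le G$ (root groups) such that, with $H:=\bigcap_{\alpha}N_G(U_\alpha)$ and $U_+:=\langle U_\alpha\mid\alpha\in\Phi(W,S)_+\rangle$: (RGD0) $U_\alpha\ne\{1\}$ for all $\alpha$; (RGD1) $[U_\alpha,U_\beta]\le\langle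 U_\gamma\mid\gamma\in(\alpha,\beta)\rangle$ for every prenilpotent pair $\{\alpha,\beta\}$ with $\alpha\neq\beta$; (RGD2) for every $s\in S$ and $1\ne u\in U_{\alpha_s}$ there exist $u',u''\in U_{-\alpha_s}$ such that $u'uu''$ conjugates $U_\beta$ onto $U_{s\beta}$ for each root $\beta$; (RGD3) $U_{-\alpha_s}\not\le U_+$ for every $s\in S$; (RGD4) $G=H\langle U_\alpha\mid\alpha\in\Phi(W,S)\rangle$. **Root bases.** A root basis is a tuple $\mathcal B=(V,\Pi,\Pi^\vee=\{\alpha^\vee\mid\alpha\in\Pi\})$ with $V$ a real vector space, $\emptyset\ne\Pi\subseteq V$, $\Pi^\vee\subseteq V^*$ such that, with $\langle\alpha,f\rangle:=f(\alpha)$ for $\alpha\in V$, $f\in V^*$: (RB1) $\langle\alpha,\alpha^\vee\rangle=2$ for all $\alpha\in\Pi$; (RB2) for distinct $\alpha,\beta\in\Pi$ either $\langle\alpha,\beta^\vee\rangle=0=\langle\beta,\alpha^\vee\rangle$, or both are $<0$ and $\langle\alpha,\beta^\vee\rangle\langle\beta,\alpha^\vee\rangle\in\{4\cos^2(\pi/k)\mid k\in\mathbb N, k\ge1\}\cup\mathbb R_{\ge4}$; (RB3) there is $f\in V^*$ with $\langle\alpha,f\rangle>0$ for all $\alpha\in\Pi$. For $\alpha\in\Pi$ let $r_\alpha(v)=v-\langle v,\alpha^\vee\rangle\alpha$; put $S(\mathcal B)=\{r_\alpha\mid\alpha\in\Pi\}$ and $W(\mathcal B)=\langle S(\mathcal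 B)\rangle\le\mathrm{GL}(V)$ (then $(W(\mathcal B),S(\mathcal B))$ is a Coxeter system), $\Phi(\mathcal B)=\{w(\alpha)\mid w\in W(\mathcal B),\alpha\in\Pi\}$, $\Phi(\mathcal B)_+=\Phi(\mathcal B)\cap\sum_{\alpha\in\Pi}\mathbb R_{\ge0}\alpha$. $\mathcal B$ is reduced if $\Phi(\mathcal B)\cap\mathbb R\alpha=\{\alpha,-\alpha\}$ for all $\alpha\in\Pi$. $\mathcal B$ is associated with $(W,S)$ if there is a bijection $S\to S(\mathcal B)$ extending to an isomorphism $W\to W(\mathcal B)$; then $W$ is identified with $W(\mathcal B)$. If $\mathcal B$ is reduced and associated with $(W,S)$, then $\Phi(\mathcal B)\to\Phi(W,S)$, $\alpha\mapsto\{w\in W\mid w^{-1}(\alpha)\in\Phi(\mathcal B)_+\}$ is a $W$-equivariant bijection; let $\varphi\colon\Phi(W,S)\to\Phi(\mathcal B)$ be its inverse. **Linearity.** For such $\mathcal B$ and a prenilpotent pair $\{\alpha,\beta\}$ put $[\alpha,\beta]^{\mathcal B}_{\mathrm{lin}}:=\{\gamma\in\Phi(W,S)\mid\varphi(\gamma)\in\mathbb R_{\ge0}\varphi(\alpha)+\mathbb R_{\ge0}\varphi(\beta)\}$ and $(\alpha,\beta)^{\mathcal B}_{\mathrm{lin}}:=[\alpha,\beta]^{\mathcal B}_{\mathrm{lin}}\setminus\{\alpha,\beta\}$. $\mathcal D$ is linear w.r.t. $\mathcal B$ if $[U_\alpha,U_\beta]\le\langle U_\gamma\mid\gamma\in(\alpha,\beta)^{\mathcal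 B}_{\mathrm{lin}}\rangle$ for every prenilpotent pair $\{\alpha,\beta\}$ with $\alpha\ne\beta$. $\mathcal D$ is linearizable if there is a reduced root basis $\mathcal B$ associated with $(W,S)$ such that $\mathcal D$ is linear w.r.t. $\mathcal B$. *)

(* Defs.v *)
(* MathComp / MathComp-Analysis. *)
From HB Require Import structures.
From mathcomp Require Import all_boot all_order all_algebra.
From mathcomp Require Import all_classical all_reals all_analysis.
Set Implicit Arguments.
Unset Strict Implicit.
Unset Printing Implicit Defensive.
Import Order.TTheory GRing.Theory Num.Theory.
Local Open Scope classical_set_scope.
Local Open Scope ring_scope.

Section Groups.
Variable G : groupType.
Implicit Types (A B : set G) (g : G).

Definition subgroup A : Prop :=
  [/\ A 1%g, forall x y, A x -> A y -> A (x * y)%g & forall x, A x -> A x^-1%g].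

Definition gen A : set G := smallest subgroup A.

Definition conj_set g A : set G := [set (g * x * g^-1)%g | x in A].

Definition normalizer A : set G := [set g | conj_set g A = A].

Definition commutator A B : set G := gen [set [~ x, y]%g | x in A & y in B].

End Groups.

(* W is presented by the generators s in S (all of order 2) and the relations
   (st)^m_st = 1, one for each pair with st of finite order m_st; the
   presentation is expressed by its universal property.  A relation f satisfies
   for n = m_st it satisfies for every n with (st)^n = 1, and conversely;
   s = t, n = 1 gives the relation s^2 = 1. *)
Definition coxeter_system (W : groupType) (S : set W) : Prop :=
  [/\ gen S = [set: W],
      forall s, S s -> s <> 1%g /\ (s * s)%g = 1%g
    & forall (H : groupType) (f : W -> H),
        (forall s t n, S s -> S t ->
           ((s * t) ^+ n)%g = 1%g -> ((f s * f t) ^+ n)%g = 1%g) ->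
        exists2 h : W -> H,
          (forall x y, h (x * y)%g = (h x * h y)%g) & {in S, h =1 f}].

Section Roots.
Variables (W : groupType) (S : set W).
Implicit Types (w s : W) (alpha beta gamma : set W).

Definition expressible_in w (n : nat) : Prop :=
  exists s : seq W,
    [/\ size s = n, {in s, forall x, S x} & (\prod_(x <- s) x)%g = w].

Definition is_length w (n : nat) : Prop :=
  expressible_in w n /\ forall m, expressible_in w m -> (n <= m)%N.

Definition length w : nat := xget 0%N (is_length w).

Definition simple_root s : set W := [set w | (length w < length (s * w)%g)%N].

Definition translate w alpha : set W := [set (w * x)%g | x in alpha].

Definition roots : set (set W) :=
  [set alpha | exists w s, S s /\ alpha = translate w (simple_root s)].

Definition pos_root alpha : Prop := roots alpha /\ alpha 1%g.
Definition neg_root alpha : Prop := roots alpha /\ ~ alpha 1%g.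

Definition prenilpotent alpha beta : Prop :=
  [/\ roots alpha /\ roots beta,
      exists w, pos_root (translate w alpha) /\ pos_root (translate w beta)
    & exists w, neg_root (translate w alpha) /\ neg_root (translate w beta)].

Definition closed_interval alpha beta : set (set W) :=
  [set gamma | roots gamma /\ forall w,
    (pos_root (translate w alpha) -> pos_root (translate w beta) ->
       pos_root (translate w gamma)) /\
    (neg_root (translate w alpha) -> neg_root (translate w beta) ->
       neg_root (translate w gamma))].

Definition open_interval alpha beta : set (set W) :=
  closed_interval alpha beta `\` [set alpha; beta].

(* U is a function on all subsets of W; only its values on roots matter. *)
Section RGDAxioms.
Variables (G : groupType) (U : set W -> set G).

Definition gen_roots (X : set (set W)) : set G :=
  gen (\bigcup_(gamma in X) U gamma).

Definition rgd_H : set G := \bigcap_(alpha in roots) normalizer (U alpha).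

Definition rgd_axioms : Prop :=
  (forall alpha, roots alpha -> subgroup (U alpha)) /\
  [/\ (* RGD0 *) forall alpha, roots alpha -> U alpha <> [set 1%g],
      (* RGD1 *) forall alpha beta, prenilpotent alpha beta -> alpha <> beta ->
        commutator (U alpha) (U beta) `<=` gen_roots (open_interval alpha beta),
      (* RGD2 *) forall s u, S s -> U (simple_root s) u -> u <> 1%g ->
        exists u' u'', [/\ U (~` simple_root s) u', U (~` simple_root s) u''
          & forall beta, roots beta ->
              conj_set (u' * u * u'')%g (U beta) = U (translate s beta)],
      (* RGD3 *) forall s, S s ->
        ~ (U (~` simple_root s) `<=` gen_roots pos_root)
    & (* RGD4 *) forall g, exists h v,
        [/\ rgd_H h, gen_roots roots v & g = (h * v)%g]].

End RGDAxioms.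
End Roots.

(* S is required to be nonempty, in accordance with the nonempty Pi of a root
   basis: with S empty there are no roots, every group would be an RGD system,
   and none of them would be associated with a root basis. *)
Record rgd_system := RGDSystem {
  rgd_W : groupType;
  rgd_S : set rgd_W;
  rgd_S_neq0 : rgd_S !=set0;
  rgd_coxeter : coxeter_system rgd_S;
  rgd_G : groupType;
  rgd_U : set rgd_W -> set rgd_G;
  rgd_ax : rgd_axioms rgd_S rgd_U
}.

Definition rgd_isomorphic (D D' : rgd_system) : Prop :=
  exists (theta : rgd_G D -> rgd_G D') (pi : rgd_W D -> rgd_W D'),
    [/\ bijective theta /\ (forall x y, theta (x * y)%g = (theta x * theta y)%g),
        bijective pi /\ (forall x y, pi (x * y)%g = (pi x * pi y)%g),
        pi @` @rgd_S D = @rgd_S D'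
      & forall alpha, roots (@rgd_S D) alpha ->
          theta @` (rgd_U alpha) = rgd_U (pi @` alpha)].

(* Only the values of coroot on Pi matter. *)
Definition root_basis_axioms (R : realType) (V : lmodType R) (Pi : set V)
    (coroot : V -> {scalar V}) : Prop :=
  [/\ Pi !=set0,
      (* RB1 *) forall a, Pi a -> coroot a a = 2,
      (* RB2 *) forall a b, Pi a -> Pi b -> a <> b ->
        (coroot b a = 0 /\ coroot a b = 0) \/
        [/\ coroot b a < 0, coroot a b < 0
          & (exists2 k : nat, (1 <= k)%N
               & coroot b a * coroot a b = 4 * cos (pi / k%:R) ^+ 2) \/
            4 <= coroot b a * coroot a b]
    & (* RB3 *) exists f : {scalar V}, forall a, Pi a -> 0 < f a].

Record root_basis (R : realType) := RootBasis {
  rb_V : lmodType R;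
  rb_Pi : set rb_V;
  rb_coroot : rb_V -> {scalar rb_V};
  rb_ax : root_basis_axioms rb_Pi rb_coroot
}.

Section RootBasis.
Variables (R : realType) (B : root_basis R).
Local Notation V := (rb_V B).

Definition refl (a : V) : V -> V := fun v => v - rb_coroot a v *: a.

Definition rb_S : set (V -> V) := [set refl a | a in @rb_Pi R B].

Definition function_group (A : set (V -> V)) : Prop :=
  [/\ A id, forall f g, A f -> A g -> A (f \o g)
    & forall f g, A f -> cancel f g -> cancel g f -> A g].

Definition rb_W : set (V -> V) := smallest function_group rb_S.

Definition rb_roots : set V := [set v | exists w a, [/\ rb_W w, rb_Pi a & v = w a]].

Definition nonneg_span (X : set V) : set V :=
  [set v | exists s : seq (R * V),
     {in s, forall p, 0 <= p.1 /\ X p.2} /\ v = \sum_(p <- s) p.1 *: p.2].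

Definition rb_pos_roots : set V := rb_roots `&` nonneg_span (@rb_Pi R B).

Definition rb_reduced : Prop :=
  forall a, rb_Pi a -> rb_roots `&` range (fun c : R => c *: a) = [set a; - a].

End RootBasis.

(* The universe of the vector spaces underlying root bases is at least that of
   Coxeter groups; without this constraint, a Coxeter group living in a larger
   universe could lack associated root bases for size reasons only. *)
Definition functions_on (R : realType) (W : groupType) : lmodType R := W -> R.

Section Linear.
Variables (R : realType) (D : rgd_system) (B : root_basis R).
Local Notation W := (rgd_W D).
Local Notation S := (@rgd_S D).
Local Notation V := (rb_V B).

(* rho is an isomorphism W -> W(B) extending a bijection S -> S(B). *)
Definition identification (rho : W -> V -> V) : Prop :=
  [/\ forall x y, rho (x * y)%g = rho x \o rho y,
      set_bij [set: W] (@rb_W R B) rho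
    & set_bij S (@rb_S R B) rho].

Variable rho : W -> V -> V.

Definition halfspace (a : V) : set W := [set w | rb_pos_roots (rho w^-1%g a)].

(* For B reduced and rho an identification, halfspace is a bijection from
   Phi(B) onto Phi(W,S), and vector_of is its inverse. *)
Definition vector_of (gamma : set W) : V :=
  xget 0 [set a | rb_roots a /\ halfspace a = gamma].

Definition closed_lin (alpha beta : set W) : set (set W) :=
  [set gamma | roots S gamma /\ exists x y : R,
     [/\ 0 <= x, 0 <= y
       & vector_of gamma = x *: vector_of alpha + y *: vector_of beta]].

Definition open_lin (alpha beta : set W) : set (set W) :=
  closed_lin alpha beta `\` [set alpha; beta].

Definition linear_wrt : Prop :=
  forall alpha beta, prenilpotent S alpha beta -> alpha <> beta ->
    commutator (rgd_U alpha) (rgd_U beta) `<=`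
      gen_roots (@rgd_U D) (open_lin alpha beta).

End Linear.

Definition linearizable (R : realType) (D : rgd_system) : Prop :=
  exists (B : root_basis R) (rho : rgd_W D -> rb_V B -> rb_V B),
    [/\ rb_reduced B, identification rho & linear_wrt rho].

(* Main.v *)
(* Let W be the free product of three groups of order 2, generated by s, t, r.
   The roots alpha_s, s alpha_t, st alpha_r are nested, the second is the only root
   between the other two, and their vectors are linearly independent in every
   root basis associated with W. Hence an RGD system over F_2 in which the
   commutator of the first and the third root group is the second one is not
   linearizable. For each n > 0 one may moreover prescribe freely whether the two
   extremal root groups along a gallery of type s t (r t)^n r commute or have the
   second root group as their commutator. An isomorphism has to induce the
   identity on S, so it preserves these choices.

   The systems are constructed through the action of the group on the chambers
   of one half of the twin building. A chamber is coded by a word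
   (a_1, e_1) ... (a_k, e_k) with a_i <> a_{i+1}, which stands for
   u_{a_1}^{e_1} n_{a_1} ... u_{a_k}^{e_k} n_{a_k} B, where u_a is the nontrivial
   element of the root group of alpha_a and n_a lifts a. The commutator relations
   determine the action of the elements of positive root groups recursively, and
   can be checked by induction on the word. *)

Require Import Defs.
From HB Require Import structures.
From mathcomp Require Import all_boot all_order all_algebra.
From mathcomp Require Import all_classical all_reals all_analysis.
From mathcomp Require Import ring lra.
(* [roots] is also defined in MathComp's [fingraph]. *)
Import Defs.
Set Implicit Arguments.
Unset Strict Implicit.
Unset Printing Implicit Defensive.
Import Order.TTheory GRing.Theory Num.Theory.
Local Open Scope classical_set_scope.

(** * Chambers and the action of root group elements *)

Section Chambers.
Variable L : eqType.

(* [comm v] says that the root groups of the first and last wall of a gallery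
   crossing walls of types [v] do not commute; their commutator is then the root
   group of the second wall. The wall in the middle has type [t] and the outer
   ones do not, so all groups generated along a gallery have class at most 2. *)
Definition admissible (t : L) (comm : pred (seq L)) := forall v, comm v ->
  exists a v' c, [/\ v = [:: a, t & rcons v' c], a != t & c != t].

Variables (t : L) (comm : pred (seq L)).
Hypothesis commP : admissible t comm.

(* A nonempty word [p] without repeated neighbours stands for the positive root
   consisting of the elements of W of which it is not a prefix, and [act p] is the
   action of the nontrivial element u_p of its root group. The equations arise
   from moving u_p across the first factor u_a^e n_a of a chamber, using
   n_a u_p n_a = u_{a p} (or u_{p'}, if p = a p'), the commutator of u_a and u_p
   in the case p = a h ..., and, if p does not start with a, the commutator of
   u_{-alpha_a} and u_p together with n_a u_a = u_a u_{-alpha_a}. The recursive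
   calls are nested, hence the fuel [n]. *)
Fixpoint act_rec n (p : seq L) (w : seq (L * bool)) : seq (L * bool) :=
  match n, w, p with
  | n.+1, (a, e) :: w', b :: p' =>
    if b == a then
      match p' with
      | [::] => (a, ~~ e) :: w'
      | h :: _ => (a, e) :: iter (e && comm p) (act_rec n [:: h]) (act_rec n p' w')
      end
    else if e then
      (a, true) :: act_rec n [:: a]
        (iter (comm (a :: p)) (act_rec n [:: b]) (act_rec n p (act_rec n [:: a] w')))
    else (a, false) :: act_rec n (a :: p) w'
  | _, _, _ => w
  end.

(** Each recursive call is made on a word one letter shorter, so the length is enough fuel. *)
Definition act p w := act_rec (size w) p w.

Arguments act : simpl never.

(** Positive root group elements change only the bits of a chamber. Hence length, and with it the
    fuel of nested calls, and reducedness are preserved. *)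
Lemma map_fst_act_rec n p w : map fst (act_rec n p w) = map fst w.
Proof.
elim: n p w => // n IH [|b p] [|[a e] w] //=; case: (b == a).
  by case: p => //= h p; case: (e && _); rewrite /= !IH.
by case: e; rewrite /= !IH //; case: (comm _); rewrite /= !IH.
Qed.

Lemma map_fst_act p w : map fst (act p w) = map fst w.
Proof. exact: map_fst_act_rec. Qed.

Lemma size_act p w : size (act p w) = size w.
Proof. by rewrite -!(size_map fst) map_fst_act. Qed.

Lemma size_act_rec n p w : size (act_rec n p w) = size w.
Proof. by rewrite -!(size_map fst) map_fst_act_rec. Qed.

Lemma act_nil p : act p [::] = [::].
Proof. by case: p. Qed.

Lemma act1_same a e w : act [:: a] ((a, e) :: w) = (a, ~~ e) :: w.
Proof. by rewrite /act /= eqxx. Qed.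

Lemma act_same a h p e w : act [:: a, h & p] ((a, e) :: w) =
  (a, e) :: iter (e && comm [:: a, h & p]) (act [:: h]) (act (h :: p) w).
Proof.
by rewrite /act /= eqxx; case: (e && _); rewrite //= /act size_act_rec.
Qed.

Lemma act_false a b p w : b != a ->
  act (b :: p) ((a, false) :: w) = (a, false) :: act [:: a, b & p] w.
Proof. by rewrite /act /= => /negPf->. Qed.

Lemma act_true a b p w : b != a ->
  act (b :: p) ((a, true) :: w) = (a, true) ::
    act [:: a] (iter (comm [:: a, b & p]) (act [:: b]) (act (b :: p) (act [:: a] w))).
Proof.
rewrite /act /= => /negPf->.
by case: (comm _); rewrite /= /act !size_act_rec.
Qed.

Lemma size_iter_act k p w : size (iter k (act p) w) = size w.
Proof. by elim: k => //= k <-; rewrite size_act. Qed.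

Lemma comm2 v : comm v -> (2 < size v)%N.
Proof. by case/commP=> a [v' [c [-> _ _]]]; rewrite /= size_rcons. Qed.

Lemma comm_2nd a h p : comm [:: a, h & p] -> h = t.
Proof. by case/commP=> ? [? [? [[_ ->]]]]. Qed.

Lemma comm_head p : ~~ comm (t :: p).
Proof. by apply/negP => /commP[? [? [? [[<- _] /eqP]]]]. Qed.

Lemma comm_last p : ~~ comm (rcons p t).
Proof.
apply/negP => /commP[a [v' [c [+ _ /eqP]]]].
by rewrite -!rcons_cons => /rcons_inj[_ ->].
Qed.

(* For [p] a nonempty prefix of [q], the word [join p q] joins the walls of [p]
   and [q], both included. *)
Definition join (p q : seq L) := drop (size p).-1 q.

Lemma join_cons c p q : p != [::] -> join (c :: p) (c :: q) = join p q.
Proof. by case: p. Qed.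

(** The relations u_p^2 = 1 and u_p u_q = u_q u_p, up to the factor u_{pt}, are proved in one
    induction on the length of the chamber: crossing its first letter involves both of them for
    shorter words. *)
Lemma act_involutive_comm n :
  (forall p w, (size w < n)%N -> act p (act p w) = w) /\
  (forall p q w, (size w < n)%N -> p != [::] -> prefix p q -> p != q ->
     act p (act q w) = act q (act p (iter (comm (join p q)) (act (rcons p t)) w))).
Proof.
elim: n => // n [IHi IHc].
(* No gallery starting at a wall of type t carries a commutator, so u_t commutes with every u_p for
   which p starts with t. *)
have IHt p w : (size w < n)%N -> p = t :: behead p ->
    act p (act [:: t] w) = act [:: t] (act p w).
  case: p => // _ p sw /= [->]; have [->//|p0] := eqVneq p [::].
  rewrite (IHc [:: t] (t :: p)) //= ?eqxx ?prefix0s //.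
    by rewrite /join /= (negPf (comm_head _)).
  by rewrite eqseq_cons eqxx /= eq_sym.
split=> [p [|[a e] w]|p q [|[a e] w]]; rewrite ?act_nil //= ?ltnS.
- move=> sw; case: p => // b p; have [->|nba] := eqVneq b a.
    case: p => [|h p]; first by rewrite !act1_same negbK.
    rewrite !act_same; case: (boolP (e && _)) => [/andP[_ /comm_2nd->]|_] /=; last by rewrite IHi.
    by rewrite IHt ?size_act // !IHi.
  case: e; last by rewrite !act_false // IHi.
  rewrite !act_true // IHi ?size_act; last by case: (comm _); rewrite /= ?size_act.
  case: (boolP (comm _)) => [/comm_2nd->|_] /=; last by rewrite IHi ?size_act // IHi.
  by rewrite (IHt (t :: p)) ?size_act // IHi ?size_act // IHi ?size_act // IHi.
- by move=> *; case: (comm _); rewrite /= ?act_nil.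
move=> sw; case: p => // b p _; case: q => // b' q.
rewrite prefix_cons => /andP[/eqP<- pq]; rewrite eqseq_cons eqxx /= => npq.
have [->|nba] := eqVneq b a.
  case: p pq npq => [_ |h p].
    case: q => // h q _; rewrite /join /=.
    have c2 : comm [:: a; t] = false by apply/negP => /comm2.
    case: (boolP (comm [:: a, h & q])) => [cq|/negPf cq] /=; last first.
      by rewrite act_same !act1_same act_same cq !andbF.
    move/comm_2nd: (cq) => ht; rewrite ht in cq *.
    rewrite act_same !act1_same act_same c2 andbF /= act1_same act_same cq !andbT.
    by case: e; rewrite /= -?IHt ?size_act ?IHi ?size_act.
  case: q => // h' q; rewrite prefix_cons => /andP[/eqP<- pq].
  rewrite eqseq_cons eqxx /= => npq; rewrite join_cons //.
  have [hpq nhpq] : prefix (h :: p) (h :: q) /\ h :: p != h :: q.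
    by rewrite prefix_cons eqseq_cons eqxx.
  (* The word of u_{pt} ends in t, so this element crosses the letter a without a correction
     term. *)
  have -> : iter (comm (join (h :: p) (h :: q))) (act [:: a, h & rcons p t]) ((a, e) :: w)
    = (a, e) :: iter (comm (join (h :: p) (h :: q))) (act (h :: rcons p t)) w.
    case: (comm (join _ _)) => //=.
    by rewrite act_same -!rcons_cons (negPf (comm_last _)) andbF.
  have := IHc (h :: p) (h :: q) w sw isT hpq nhpq.
  rewrite !act_same; set X := iter _ _ w => IHpq; congr (_ :: _).
  have sX : (size X < n)%N by rewrite size_iter_act.
  (* A correction term u_h occurs only for h = t. It then commutes with the other elements, and both
     sides collect the same corrections. *)
  have [ht|nht] := eqVneq h t.
    rewrite ht in X sX IHpq *.
    by do 2!case: (e && _); rewrite /= ?(IHt (t :: p)) ?(IHt (t :: q)) ?IHi ?size_act // IHpq.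
  have ncomm r : comm [:: a, h & r] = false.
    by apply: contraNF nht => /comm_2nd->.
  by rewrite !ncomm !andbF.
have [npq0 bpq] : b :: p != b :: q /\ prefix (b :: p) (b :: q).
  by rewrite prefix_cons eqseq_cons eqxx.
have IHpq x (sx : (size x < n)%N) := IHc (b :: p) (b :: q) x sx isT bpq npq0.
case: e.
  have -> : iter (comm (join (b :: p) (b :: q))) (act (rcons (b :: p) t)) ((a, true) :: w)
    = (a, true) :: act [:: a] (iter (comm (join (b :: p) (b :: q))) (act (rcons (b :: p) t)) (act [:: a] w)).
    case: (comm (join _ _)) => /=; last by rewrite IHi.
    by rewrite act_true // -!rcons_cons (negPf (comm_last _)).
  rewrite !act_true //; congr (_ :: _).
  set x := act [:: a] w; have sx : (size x < n)%N by rewrite size_act.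
  have := IHpq x sx; set X := iter _ _ x => {}IHpq.
  have sX : (size X < n)%N by rewrite size_iter_act.
  rewrite !IHi ?size_iter_act ?size_act //; congr (act _ _).
  have [bt|nbt] := eqVneq b t.
    rewrite bt in X sX IHpq *.
    by do 2!case: (comm _); rewrite /= ?(IHt (t :: p)) ?(IHt (t :: q)) ?IHi ?size_act // IHpq.
  have ncomm r : comm [:: a, b & r] = false.
    by apply: contraNF nbt => /comm_2nd->.
  by rewrite !ncomm.
have := IHc (a :: b :: p) (a :: b :: q) w sw isT.
rewrite prefix_cons eqxx [a :: _ == _]eqseq_cons eqxx => /(_ bpq npq0).
have -> : iter (comm (join (b :: p) (b :: q))) (act (rcons (b :: p) t)) ((a, false) :: w)
    = (a, false) :: iter (comm (join (b :: p) (b :: q))) (act (rcons (a :: b :: p) t)) w.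
  by case: (comm (join _ _)) => //=; rewrite act_false.
by rewrite join_cons // !act_false // => ->.
Qed.

Lemma actK p : involutive (act p).
Proof. by move=> w; have [+ _] := act_involutive_comm (size w).+1; apply. Qed.

Lemma act_comm p q w : p != [::] -> prefix p q -> p != q ->
  act p (act q w) = act q (act p (iter (comm (join p q)) (act (rcons p t)) w)).
Proof. by have [_ +] := act_involutive_comm (size w).+1; apply. Qed.

(** * Chambers and the lifts n_a of the generators *)

Definition reduced : pred (seq L) := sorted (fun a b => a != b).

Definition chamber (w : seq (L * bool)) := reduced (map fst w).

Lemma chamber_act p w : chamber w -> chamber (act p w).
Proof. by rewrite /chamber map_fst_act. Qed.

(* The action of n_a on chambers. *)
Definition flip a (w : seq (L * bool)) : seq (L * bool) :=
  match w with
  | (b, e) :: w' => if b == a then if e then (a, true) :: act [:: a] w' else w'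
                    else (a, false) :: w
  | [::] => [:: (a, false)]
  end.

Definition starts a (w : seq (L * bool)) :=
  if w is (b, _) :: _ then b == a else false.

(** This is n_a u_a n_a = u_a n_a u_a. *)
Lemma flip_true a w : flip a ((a, true) :: w) = (a, true) :: act [:: a] w.
Proof. by rewrite /= eqxx. Qed.

Lemma flip_false a w : flip a ((a, false) :: w) = w.
Proof. by rewrite /= eqxx. Qed.

Lemma flip_new a w : ~~ starts a w -> flip a w = (a, false) :: w.
Proof. by case: w => [|[b e] w] //= /negPf->. Qed.

Lemma starts_act a p w : starts a (act p w) = starts a w.
Proof. by case: w (act p w) (map_fst_act p w) => [|[b e] w] [|[c f] v] //= [->]. Qed.

Lemma chamber_cons a e w : chamber ((a, e) :: w) = ~~ starts a w && chamber w.
Proof. by case: w => [|[b f] w] //; rewrite /chamber /= eq_sym. Qed.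

Lemma chamber_flip a w : chamber w -> chamber (flip a w).
Proof.
have [wa|nwa] := boolP (starts a w); last by rewrite flip_new // chamber_cons nwa.
case: w wa => [|[b e] w] //; move=> /= /eqP<-; rewrite eqxx.
rewrite chamber_cons => /andP[nw cw].
by case: e => //; rewrite chamber_cons starts_act nw chamber_act.
Qed.

Variant chamber_spec a w : seq (L * bool) -> Prop :=
| ChamberNew of ~~ starts a w : chamber_spec a w w
| ChamberCons e w' of ~~ starts a w' & w = (a, e) :: w' : chamber_spec a w ((a, e) :: w').

Lemma chamberP a w : chamber w -> chamber_spec a w w.
Proof.
have [wa|nwa] := boolP (starts a w); last by left.
case: w wa => [|[b e] w] //; move=> /= /eqP->.
by rewrite chamber_cons => /andP[nw _]; right.
Qed.

Lemma flipK a w : chamber w -> flip a (flip a w) = w.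
Proof.
case/(chamberP a) => [nw|[] w' nw' _]; first by rewrite (flip_new nw) flip_false.
  by rewrite !flip_true actK.
by rewrite flip_false flip_new.
Qed.

(** As in the rank one group SL_2(F_2), which is S_3, the two involutions satisfy a braid relation.
    The cases are the three chambers [w], [(a, true) :: w] and [(a, false) :: w] of a panel. *)
Lemma flip_braid a w : chamber w ->
  act [:: a] (flip a (act [:: a] w)) = flip a (act [:: a] (flip a w)).
Proof.
case/(chamberP a) => [nw|[] w' nw' _].
- by rewrite (flip_new nw) flip_new ?starts_act // !act1_same flip_true.
- by rewrite flip_true !act1_same !flip_false.
- by rewrite flip_false !act1_same flip_true act1_same flip_new ?starts_act.
Qed.

(** The conjugation rule n_a u_p n_a = u_{ap}, from which the clauses of [act_rec] were derived, is
    recovered from them. *)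
Lemma flip_act a p w : p != [::] -> ohead p != Some a -> chamber w ->
  flip a (act p w) = act (a :: p) (flip a w).
Proof.
case: p => // b p _ /= nab; have {}nab : b != a by [].
case/(chamberP a) => [nw|[] w' nw' _].
- by rewrite (flip_new nw) flip_new ?starts_act // act_same.
- by rewrite act_true // !flip_true act_same actK.
- by rewrite act_false // !flip_false.
Qed.

End Chambers.

(** * The free product W *)

Section Words.
Variable L : choiceType.
Implicit Types (a b : L) (p q : seq L).

Record word := Word { letters :> seq L; wordP : reduced letters }.
HB.instance Definition _ := [isSub for letters].
HB.instance Definition _ := [Choice of word by <:].

(** Left multiplication of a reduced word by a letter. By [pushK] it is an involution on reduced
    words, so the free product acts on its normal forms (van der Waerden's trick). *)
Definition push a p := if p is b :: p' then if b == a then p' else a :: p else [:: a].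

Lemma reduced_cons a p : reduced (a :: p) = (ohead p != Some a) && reduced p.
Proof. by case: p => [|b p] //; rewrite /reduced /= eq_sym. Qed.

Lemma reduced_rev p : reduced (rev p) = reduced p.
Proof. by rewrite /reduced rev_sorted; apply: eq_sorted => a b; rewrite eq_sym. Qed.

Lemma reduced_push a p : reduced p -> reduced (push a p).
Proof.
case: p => // b p; rewrite /push; case: eqVneq => [_|nba].
  by rewrite reduced_cons => /andP[].
by move=> rbp; rewrite reduced_cons rbp andbT.
Qed.

Lemma push_id a p : ohead p != Some a -> push a p = a :: p.
Proof. by case: p => // b p nba; rewrite /push (negPf (nba : b != a)). Qed.

Lemma pushK a p : reduced p -> push a (push a p) = p.
Proof.
case: p => [|b p]; first by rewrite /= eqxx.
rewrite reduced_cons => /andP[hb _]; rewrite {2}/push.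
have [<-|nba] := eqVneq b a; first exact: push_id.
by rewrite /= eqxx.
Qed.

Definition mulw p q := foldr push q p.

Lemma reduced_mulw p q : reduced q -> reduced (mulw p q).
Proof. by move=> rq; elim: p => //= a p IH; apply: reduced_push. Qed.

Lemma mulw_push a p q : reduced q -> mulw (push a p) q = push a (mulw p q).
Proof.
move=> rq; case: p => // b p; rewrite /push; case: eqVneq => [->|//].
by rewrite [RHS]pushK // reduced_mulw.
Qed.

Lemma mulwA p q x : reduced x -> mulw p (mulw q x) = mulw (mulw p q) x.
Proof. by move=> rx; elim: p => //= a p ->; rewrite mulw_push. Qed.

Lemma mulw_id p : reduced p -> mulw p [::] = p.
Proof.
elim: p => // a p IH; rewrite reduced_cons => /andP[ha rp].
by rewrite /= IH // push_id.
Qed.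

Lemma mulVw p q : reduced q -> mulw (rev p) (mulw p q) = q.
Proof.
move=> rq; elim/last_ind: p q rq => // p a IH q rq.
have -> : mulw (rcons p a) q = mulw p (push a q) by exact: foldr_rcons.
by rewrite rev_rcons /= IH ?pushK ?reduced_push.
Qed.

Definition word1 : word := @Word [::] isT.
Definition wordM (x y : word) : word := Word (reduced_mulw x (wordP y)).
Definition wordV (x : word) : word := @Word (rev x) (etrans (reduced_rev x) (wordP x)).

Fact wordMA : associative wordM.
Proof. by move=> x y z; apply: val_inj; apply/mulwA/wordP. Qed.
Fact word1M : left_id word1 wordM.
Proof. by move=> x; apply: val_inj. Qed.
Fact wordM1 : right_id word1 wordM.
Proof. by move=> x; apply: val_inj; apply/mulw_id/wordP. Qed.
Fact wordVM : left_inverse word1 wordV wordM.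
Proof.
by move=> x; apply: val_inj; rewrite /= -[X in mulw _ X](mulw_id (wordP x)) mulVw.
Qed.
Fact wordMV : right_inverse word1 wordV wordM.
Proof.
by move=> x; apply: val_inj; rewrite /= -{1}(revK x) -[X in mulw _ X](mulw_id (wordP (wordV x))) mulVw.
Qed.

HB.instance Definition _ := isGroup.Build word wordMA word1M wordM1 wordVM wordMV.

Definition letter a : word := @Word [:: a] isT.
Definition letters_set : set word := range letter.

Lemma letter_inj : injective letter.
Proof. by move=> a b [->]. Qed.

Lemma letter_mul a (x : word) : letters (letter a * x)%g = push a x.
Proof. by []. Qed.

Lemma letterK a : (letter a * letter a = 1)%g.
Proof. by apply: val_inj; rewrite /= eqxx. Qed.

Lemma letterV a : ((letter a)^-1 = letter a)%g.
Proof. by apply: val_inj. Qed.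

Lemma word_cons a p (h : reduced (a :: p)) (h' : reduced p) :
  Word h = (letter a * Word h')%g.
Proof.
by apply: val_inj; rewrite /= push_id //; move: h; rewrite reduced_cons => /andP[].
Qed.

Lemma word_ind (P : word -> Prop) : P 1%g ->
  (forall a (x : word), ohead x != Some a -> P x -> P (letter a * x)%g) -> forall x, P x.
Proof.
move=> P1 PM [p]; elim: p => [|a p IH] h; first by rewrite (_ : Word h = 1%g) //; apply: val_inj.
have /andP[ha h'] : (ohead p != Some a) && reduced p by rewrite -reduced_cons.
by rewrite (word_cons _ h'); apply: PM => //; apply: IH.
Qed.

Lemma prod_letters (x : word) : (\prod_(a <- letters x) letter a)%g = x.
Proof.
elim/word_ind: x => [|a x ha IH]; first by rewrite big_nil.
by rewrite letter_mul push_id // big_cons IH.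
Qed.

(** A letter lengthens a reduced word by at most one, so reduced words are shortest expressions. *)
Lemma size_prod_letters (s : seq word) : {in s, forall x, letters_set x} ->
  (size (letters (\prod_(x <- s) x)%g) <= size s)%N.
Proof.
elim: s => [|x s IH] hs; first by rewrite big_nil.
rewrite big_cons; have [a _ <-] : letters_set x by apply: hs; rewrite mem_head.
rewrite letter_mul /=; apply: (@leq_trans (size (letters (\prod_(x <- s) x)%g)).+1).
  by case: (letters _) => //= b p; case: eqP => //= _; rewrite ltnW.
by rewrite ltnS IH // => y ys; apply: hs; rewrite in_cons ys orbT.
Qed.

Lemma length_word (x : word) : length letters_set x = size x.
Proof.
have ex : expressible_in letters_set x (size x).
  exists (map letter x); split; first by rewrite size_map.
    by move=> y /mapP[a _ ->]; exists a.
  by rewrite big_map prod_letters.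
have lb m : expressible_in letters_set x m -> (size x <= m)%N.
  by case=> s [<- hs <-]; apply: size_prod_letters.
apply: xget_unique => // m [hm minm].
by apply/eqP; rewrite eqn_leq lb // minm.
Qed.

Lemma letters_set_gen : gen letters_set = [set: word].
Proof.
apply/seteqP; split=> // x _ A /= [[A1 AM _] LA].
elim/word_ind: x => // a x _ Ax; apply: AM => //; apply: LA; by exists a.
Qed.

Lemma word_coxeter : coxeter_system letters_set.
Proof.
split; first exact: letters_set_gen.
  by move=> _ [a _ <-]; split; last exact: letterK.
move=> H f frel.
(* The relation for s = t and n = 1 makes the images of letters square to 1, so that the product
   over reduced words is multiplicative. *)
have f2 a : (f (letter a) * f (letter a) = 1)%g.
  by have := frel (letter a) (letter a) 1%N; rewrite !expg1; apply; [exists a|exists a|exact: letterK].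
pose h (x : word) := (\prod_(a <- letters x) f (letter a))%g.
have h1 a x : (h (letter a * x) = f (letter a) * h x)%g.
  rewrite /h letter_mul /=; case: (letters x) => [|b p] /=; first by rewrite big_seq1 big_nil mulg1.
  by case: eqP => [->|_]; rewrite !big_cons // mulgA f2 mul1g.
exists h.
  move=> x y; elim/word_ind: x => [|a x _ IH]; last by rewrite -mulgA !h1 IH mulgA.
  by rewrite mul1g [h 1%g]big_nil mul1g.
by move=> x /set_mem[a _ <-]; rewrite /h big_seq1.
Qed.

End Words.

(** * Roots of W *)

Section Translate.
Variable W : groupType.
Implicit Types (x y : W) (A B : set W).

Lemma translateE x A y : translate x A y = A (x^-1 * y)%g.
Proof.
apply/propext; split=> [[z Az <-]|Ay]; first by rewrite mulKg.
by exists (x^-1 * y)%g => //; rewrite mulVKg.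
Qed.

Lemma translate1 A : translate 1%g A = A.
Proof. by apply/funext => y; rewrite translateE invg1 mul1g. Qed.

Lemma translateM x y A : translate (x * y)%g A = translate x (translate y A).
Proof. by apply/funext => z; rewrite !translateE invgM mulgA. Qed.

Lemma translateK x A : translate x^-1%g (translate x A) = A.
Proof. by rewrite -translateM mulVg translate1. Qed.

Lemma translateC x A : translate x (~` A) = ~` translate x A.
Proof. by apply/funext => y; rewrite translateE /setC /= translateE. Qed.

Lemma roots_translate (S : set W) x A : roots S A -> roots S (translate x A).
Proof. by move=> [y [s [Ss ->]]]; exists (x * y)%g, s; rewrite translateM. Qed.

End Translate.

Section WordRoots.
Variable L : choiceType.
Implicit Types (a b : L) (p q : seq L) (x y : word L).
Local Notation S := (@letters_set L).

Lemma reduced_rcons p a : reduced (rcons p a) = (ohead (rev p) != Some a) && reduced p.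
Proof. by rewrite -reduced_rev rev_rcons reduced_cons reduced_rev. Qed.

(** In the Cayley tree of W, this is the half containing 1 after removal of the last edge of the
    gallery p. For nonempty reduced p these are exactly the positive roots. *)
Definition avoid p : set (word L) := [set x | ~~ prefix p x].

Lemma simple_root_letter a : simple_root S (letter a) = avoid [:: a].
Proof.
apply/funext => x; apply/propext; rewrite /simple_root /avoid /= !length_word letter_mul.
case: (letters x) => [|b p] /=; first by [].
rewrite prefix0s andbT [a == b]eq_sym.
by case: eqP => _ /=; rewrite ?ltnSn // ltnNge leqnSn.
Qed.

Lemma translate_letter_avoid a p : p != [::] -> ohead p != Some a ->
  translate (letter a) (avoid p) = avoid (a :: p).
Proof.
case: p => // b p _ nba; have {}nba : (b == a) = false by apply: negPf.
apply/funext => x; rewrite translateE letterV /avoid /=.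
case: (letters x) => [|c q] /=; first by rewrite nba.
by rewrite [a == c]eq_sym; case: eqP => [_|_] //=; rewrite nba.
Qed.

Lemma translate_letter_same a :
  translate (letter a) (avoid [:: a]) = ~` avoid [:: a].
Proof.
apply/funext => x; rewrite translateE letterV /avoid /setC /=.
apply/propext; rewrite (rwP negP) negbK.
case: x => -[|b p] rp /=; first by rewrite eqxx.
have hp : ohead p != Some b by move: rp; rewrite reduced_cons => /andP[].
rewrite prefix0s andbT [a == b]eq_sym; have [<-|] := eqVneq b a; last by rewrite /= eqxx.
case: p hp {rp} => //= c p hp; rewrite prefix0s andbT eq_sym.
by split=> // _; apply: hp.
Qed.

Lemma root_pos x a : reduced (rcons x a) ->
  translate x (simple_root S (letter a)) = avoid (rcons x a).
Proof.
elim/word_ind: x => [|b x hb IH]; first by rewrite translate1 simple_root_letter.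
rewrite letter_mul push_id // rcons_cons reduced_cons => /andP[hbx /IH e].
rewrite translateM e translate_letter_avoid //.
by case: (letters x).
Qed.

(** This decides the sign of x alpha_a: the root is positive with word xa if xa is reduced;
    otherwise x = ya and it is the complement of y alpha_a. *)
Variant last_letter_spec x a : Prop :=
| LastNe of reduced (rcons x a)
| LastEq y of reduced (rcons y a) & x = (y * letter a)%g & letters x = rcons y a.

Lemma last_letterP x a : last_letter_spec x a.
Proof.
have [h|] := boolP (reduced (rcons x a)); first by left.
rewrite reduced_rcons wordP andbT negbK => /eqP h.
have ex : letters x = rcons (rev (behead (rev x))) a.
  by rewrite -rev_cons -[LHS]revK; case: (rev x) h => //= b p [->].
have ry : reduced (rev (behead (rev x))).
  by have := wordP x; rewrite {1}ex reduced_rcons => /andP[].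
move: (rev (behead (rev x))) ry ex => q ry ex.
have rqa : reduced (rcons q a) by rewrite -ex wordP.
right with (Word ry) => //; apply: val_inj => /=; rewrite ex.
elim: q rqa {ry ex} => // b q IH.
by rewrite rcons_cons reduced_cons => /andP[hb /IH /= <-]; rewrite push_id.
Qed.

Lemma root_neg x y a : reduced (rcons y a) -> x = (y * letter a)%g ->
  translate x (simple_root S (letter a)) = ~` avoid (rcons y a).
Proof.
move=> ry ->; rewrite translateM simple_root_letter translate_letter_same.
by rewrite translateC -simple_root_letter root_pos.
Qed.

Lemma avoid1 p : p != [::] -> avoid p 1%g.
Proof. by case: p. Qed.

Lemma avoid_inj p q : reduced p -> reduced q -> avoid p = avoid q -> p = q.
Proof.
move=> rp rq e.
have pre p' q' (r : reduced p') : avoid q' = avoid p' -> prefix q' p'.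
  move=> e'; have : ~ avoid p' (Word r) by rewrite /avoid /= prefix_refl.
  by rewrite -e' /avoid /= => /negP; rewrite negbK.
have := pre _ _ rq e; have := pre _ _ rp (esym e).
elim: p q {rp rq e pre} => [|a p IH] [|b q] //=.
by move=> /andP[/eqP-> pq] /andP[_ qp]; rewrite (IH q).
Qed.

Lemma root_posP A : pos_root S A ->
  exists p, [/\ reduced p, p != [::] & A = avoid p].
Proof.
move=> [[x [_ [[a _ <-] ->]]]]; case: (last_letterP x a) => [r|y r e _].
  by rewrite root_pos // => _; exists (rcons x a); split => //; case: (letters x).
by rewrite (root_neg r e) => /(_ (avoid1 _)) []; case: (letters y).
Qed.

Lemma pos_avoid p : reduced p -> p != [::] -> pos_root S (avoid p).
Proof.
move=> rp p0; split; last exact: avoid1.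
case/lastP: p rp p0 => // p a r _; have := r.
rewrite reduced_rcons => /andP[_ rp].
exists (Word rp), (letter a); split; first by exists a.
by rewrite root_pos.
Qed.

(** Positive roots correspond to nonempty reduced words, so x alpha_a = alpha_b forces x = 1. Root
    groups and root vectors can therefore be indexed by pairs (x, a). *)
Lemma root_inj x y a b :
  translate x (simple_root S (letter a)) = translate y (simple_root S (letter b)) ->
  x = y /\ a = b.
Proof.
move/(congr1 (translate y^-1%g)); rewrite translateK -translateM.
case: (last_letterP (y^-1 * x)%g a) => [r|z r e _].
  rewrite root_pos // simple_root_letter => /(avoid_inj r (isT : reduced [:: b])).
  case lx: (letters (y^-1 * x)%g) => [|c [|? ?]] //= [->]; split=> //.
  have yx : (y^-1 * x)%g = 1%g by apply: val_inj.
  by rewrite -[x](mulVKg y) yx mulg1.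
rewrite (root_neg r e) simple_root_letter => /(congr1 (fun A => A 1%g)) h.
have : avoid [:: b] 1%g by [].
by rewrite -h => /(_ (avoid1 _)) []; case: (letters z).
Qed.

Lemma prefix_total p q s : prefix p s -> prefix q s -> prefix p q || prefix q p.
Proof.
elim: p q s => [|a p IH] [|b q] [|c s] //=; rewrite ?prefix0s //.
by move=> /andP[/eqP-> ps] /andP[/eqP-> qs]; rewrite eqxx /= (IH q s).
Qed.

(** An element outside both roots has both words as prefixes. *)
Lemma prenilpotent_avoid p q : prenilpotent S (avoid p) (avoid q) ->
  prefix p q || prefix q p.
Proof.
case=> _ _ [x [[_ hp] [_ hq]]]; move: hp hq; rewrite !translateE mulg1 /avoid /=.
by move=> /negP; rewrite negbK => px /negP; rewrite negbK; apply: prefix_total.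
Qed.

Lemma prenilpotent_prefix p q : reduced p -> reduced q -> p != [::] -> prefix p q ->
  prenilpotent S (avoid p) (avoid q).
Proof.
move=> rp rq p0 pq; have q0 : q != [::] by case: p p0 pq {rp} => // ? ?; case: (q).
have [pp pq'] := (pos_avoid rp p0, pos_avoid rq q0).
split; first by split; [case: pp|case: pq'].
  by exists 1%g; rewrite !translate1.
(* The element q itself lies outside both roots. *)
exists (Word rq)^-1%g; split; split; rewrite ?translateE ?invgK ?mulg1 /avoid /=.
- by apply: roots_translate; case: pp.
- by rewrite pq.
- by apply: roots_translate; case: pq'.
- by rewrite prefix_refl.
Qed.

Lemma avoid_sub p q : prefix p q -> avoid p `<=` avoid q.
Proof. by move=> pq x /=; apply: contraNN; apply: prefix_trans. Qed.

Lemma avoid_subP p q : reduced q -> avoid p `<=` avoid q -> prefix p q.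
Proof.
move=> rq pq; have : ~ avoid q (Word rq) by rewrite /avoid /= prefix_refl.
by move/(contra_not (pq (Word rq))); rewrite /avoid /= => /negP; rewrite negbK.
Qed.

(** Positivity passes from A to the larger root C, negativity from B to the smaller root C. *)
Lemma between_interval (A B C : set (word L)) : roots S B -> roots S C ->
  A `<=` C -> C `<=` B -> closed_interval S A B C.
Proof.
move=> rB rC AC CB; split=> // x; rewrite /pos_root /neg_root !translateE.
by split=> [[_ h] _|_ [_ h]]; (split; first exact: roots_translate); auto.
Qed.

End WordRoots.

(** * RGD systems of type W *)

Section Groups.
Variable G : groupType.
Implicit Types (A B : set G) (x y z : G).

Lemma gen_subgroup A : subgroup (gen A).
Proof.
split=> [B [[B1 _ _] _] //|x y Ax Ay B hB|x Ax B hB].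
  by case: (hB) => [[_ BM _] _]; apply: BM; [apply: Ax|apply: Ay].
by case: (hB) => [[_ _ BV] _]; apply: BV; apply: Ax.
Qed.

Lemma sub_gen A : A `<=` gen A.
Proof. by move=> x Ax B [_]; apply. Qed.

Lemma gen_sub A B : subgroup B -> A `<=` B -> gen A `<=` B.
Proof. by move=> hB AB x; apply. Qed.

Lemma gen_set0 : gen (set0 : set G) `<=` [set 1%g].
Proof.
apply: gen_sub => //; split=> //= [x y -> ->|x ->]; first by rewrite mulg1.
by rewrite invg1.
Qed.

Lemma commgV x y : ([~ x, y]^-1 = [~ y, x])%g.
Proof. by rewrite /commg /conjg !invgM !invgK !mulgA. Qed.

Lemma comm1g y : ([~ 1, y] = 1 :> G)%g.
Proof. by rewrite /commg /conjg invg1 mul1g mul1g mulVg. Qed.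

Lemma commg1 y : ([~ y, 1] = 1 :> G)%g.
Proof. by rewrite -commgV comm1g invg1. Qed.

End Groups.

Section Morphism.
Variables (G H : groupType) (f : G -> H).
Hypothesis fM : forall x y, (f (x * y) = f x * f y)%g.

Lemma morph1 : (f 1 = 1)%g.
Proof. by apply: (mulgI (f 1%g)); rewrite -fM !mulg1. Qed.

Lemma morphV x : (f x^-1 = (f x)^-1)%g.
Proof. by apply: (mulgI (f x)); rewrite -fM !mulgV morph1. Qed.

Lemma morphR x y : (f [~ x, y] = [~ f x, f y])%g.
Proof. by rewrite /commg /conjg !fM !morphV. Qed.

Lemma morph_image_subgroup A : subgroup A -> subgroup (f @` A).
Proof.
case=> A1 AM AV; split=> /= [|_ _ [x Ax <-] [y Ay <-]|_ [x Ax <-]].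
- by exists 1%g => //; exact: morph1.
- by exists (x * y)%g; [apply: AM|rewrite fM].
- by exists x^-1%g; [apply: AV|rewrite morphV].
Qed.

End Morphism.

Section Intervals.
Variables (W : groupType) (S : set W).

Lemma translate_inj (w : W) : injective (translate w).
Proof. by move=> A B /(congr1 (translate w^-1%g)); rewrite !translateK. Qed.

Lemma open_interval_translate w A B C : open_interval S A B C ->
  open_interval S (translate w A) (translate w B) (translate w C).
Proof.
move=> [[rC h] nC]; split; last first.
  by move=> /= [|] /translate_inj e; apply: nC; [left|right].
split; first exact: roots_translate.
by move=> x; rewrite -!translateM.
Qed.

Lemma open_intervalC A B : open_interval S A B `<=` open_interval S B A.
Proof.
move=> C [[rC h] nC]; split; last by move=> /= [|] e; apply: nC; [right|left].
split=> // x; have [h1 h2] := h x.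
by split=> *; [apply: h1|apply: h2].
Qed.

End Intervals.

Lemma letters_set_neq0 (L : choiceType) (a : L) : @letters_set L !=set0.
Proof. by exists (letter a), a. Qed.

(** * A criterion for RGD systems of type W over F_2 *)

Section WordRGD.
Variables (L : choiceType) (t : L) (comm : pred (seq L)).
Hypothesis commP : admissible t comm.
Local Notation S := (@letters_set L).

(** [u p] is to be the nontrivial element of the root group of p, [n a] a lift of a, and [F] a
    subgroup containing the positive root groups but no negative simple one, as needed for RGD3. *)
Variables (G : groupType) (u : seq L -> G) (n : L -> G) (F : set G).
Hypothesis u_sqr : forall a, (u [:: a] * u [:: a] = 1)%g.
Hypothesis n_sqr : forall a, (n a * n a = 1)%g.
Hypothesis braid : forall a, (u [:: a] * n a * u [:: a] = n a * u [:: a] * n a)%g.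
Hypothesis n_u : forall a p, reduced (a :: p) -> p != [::] ->
  (n a * u p * n a = u (a :: p))%g.
Hypothesis u_u : forall p q, reduced q -> p != [::] -> prefix p q -> p != q ->
  (u p * u q = u q * u p * (if comm (join p q) then u (rcons p t) else 1))%g.
Hypothesis F_subgroup : subgroup F.
Hypothesis F_u : forall p, reduced p -> p != [::] -> F (u p).
Hypothesis F_n : forall a, ~ F (n a * u [:: a] * n a)%g.
Hypothesis G_gen : gen (range (fun a => u [:: a]) `|` range n) = [set: G].

Implicit Types (x y w : word L) (a : L) (p q : seq L).

Definition nw x : G := (\prod_(a <- letters x) n a)%g.

Lemma nw_letter a x : (nw (letter a * x) = n a * nw x)%g.
Proof.
rewrite /nw letter_mul; case: (letters x) => [|b p] /=; first by rewrite big_seq1 big_nil mulg1.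
by case: eqP => [->|_]; rewrite !big_cons // mulgA n_sqr mul1g.
Qed.

Lemma nw1 : nw 1%g = 1%g.
Proof. exact: big_nil. Qed.

Lemma nwM x y : (nw (x * y) = nw x * nw y)%g.
Proof.
elim/word_ind: x => [|a x _ IH]; first by rewrite nw1 !mul1g.
by rewrite -mulgA !nw_letter IH mulgA.
Qed.

Lemma nw_gen a : nw (letter a) = n a.
Proof. exact: big_seq1. Qed.

Lemma nV a : ((n a)^-1 = n a)%g.
Proof. by apply: (mulgI (n a)); rewrite mulgV n_sqr. Qed.

Definition rt x a : G := (nw x * u [:: a] * (nw x)^-1)%g.

(** On roots this is a group of order two, since by [root_inj] the root determines x and a. *)
Definition rootgrp (A : set (word L)) : set G := [set g | exists x a,
  A = translate x (simple_root S (letter a)) /\ (g = 1%g \/ g = rt x a)].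

Lemma rt_pos x a : reduced (rcons x a) -> rt x a = u (rcons x a).
Proof.
elim/word_ind: x => [|b x hb IH]; first by rewrite /rt nw1 mul1g invg1 mulg1.
rewrite letter_mul push_id // rcons_cons => h; have := h.
rewrite reduced_cons => /andP[_ rx].
rewrite -n_u // -?IH //; first by rewrite /rt nw_letter invgM nV !mulgA.
by case: (letters x).
Qed.

Lemma rtM x y a : rt (x * y)%g a = (nw x * rt y a * (nw x)^-1)%g.
Proof. by rewrite /rt nwM invgM !mulgA. Qed.

Lemma rootgrp_root x a :
  rootgrp (translate x (simple_root S (letter a))) = [set 1%g; rt x a].
Proof.
apply/seteqP; split=> [g [y [b [/root_inj[-> ->]]]] //|g /= h].
by exists x, a.
Qed.

Lemma rootgrp_avoid p : reduced p -> p != [::] -> rootgrp (avoid p) = [set 1%g; u p].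
Proof.
case/lastP: p => // p a r _; have := r; rewrite reduced_rcons => /andP[_ rp].
by rewrite -(@root_pos _ (Word rp)) // rootgrp_root rt_pos.
Qed.

Lemma u_rt x a : u [:: a] = ((nw x)^-1 * rt x a * nw x)%g.
Proof. by rewrite /rt !mulgA mulVg mul1g mulgVK. Qed.

(** If u_p were trivial, so would be its conjugate u_a, and n_a u_a n_a = 1 would lie in F. *)
Lemma u_neq1 p : reduced p -> p != [::] -> u p <> 1%g.
Proof.
case/lastP: p => // p a r _; have := r; rewrite reduced_rcons => /andP[_ rp].
rewrite -[rcons p a]/(rcons (Word rp) a) -rt_pos // => e.
have ua : u [:: a] = 1%g.
  by rewrite (u_rt (Word rp)) e mulg1 mulVg.
by apply: (@F_n a); rewrite ua mulg1 n_sqr; case: F_subgroup.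
Qed.

Lemma rt_neq1 x a : rt x a <> 1%g.
Proof.
move=> e; apply: (@u_neq1 [:: a]) => //.
by rewrite (u_rt x) e mulg1 mulVg.
Qed.

Lemma rt_sqr x a : (rt x a * rt x a = 1)%g.
Proof. by rewrite /rt !mulgA mulgVK -(mulgA _ (u _) (u _)) u_sqr // mulg1 mulgV. Qed.

Lemma rootgrp_subgroup A : roots S A -> subgroup (rootgrp A).
Proof.
move=> [x [_ [[a _ <-] ->]]]; rewrite rootgrp_root; split.
- by left.
- move=> g h [->|->] [->|->]; rewrite ?mulg1 ?mul1g ?rt_sqr; by [left|right].
- move=> g [->|->]; first by rewrite invg1; left.
  by right; apply: (mulgI (rt x a)); rewrite mulgV rt_sqr.
Qed.

Lemma rootgrp_conj x A g : roots S A ->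
  rootgrp A g -> rootgrp (translate x A) (nw x * g * (nw x)^-1)%g.
Proof.
move=> [y [_ [[a _ <-] ->]]]; rewrite -translateM !rootgrp_root => -[->|->].
  by left; rewrite mulg1 mulgV.
by right; rewrite rtM.
Qed.

Lemma conj_rootgrp x A : roots S A ->
  conj_set (nw x) (rootgrp A) = rootgrp (translate x A).
Proof.
move=> rA; apply/seteqP; split=> [_ [g Ag <-]|g xAg]; first exact: rootgrp_conj.
exists (nw x^-1 * g * (nw x^-1)^-1)%g; first last.
  by rewrite !(morphV nwM) invgK !mulgA mulgV mul1g mulgK.
have := rootgrp_conj x^-1%g (roots_translate x rA) xAg.
by rewrite translateK.
Qed.

Lemma reduced_prefix p q : prefix p q -> reduced q -> reduced p.
Proof.
case/prefixP => q' ->; rewrite /reduced => /cat_sorted2[]//.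
Qed.

(** The word pt belongs to the second wall of the gallery from p to q. A gallery carrying a
    commutator has at least three walls, which puts pt strictly between p and q. *)
Lemma comm_join p q : p != [::] -> prefix p q -> comm (join p q) ->
  [/\ prefix (rcons p t) q, rcons p t != q & rcons p t != p].
Proof.
move=> p0 /prefixP[q' ->] /commP [a [v [c [+ _ hc]]]].
case/lastP: p p0 => // p b _; rewrite /join size_rcons /= cat_rcons drop_size_cat // => -[-> ->].
rewrite -cat_rcons -[t :: _]cat1s catA cats1 prefix_prefix; split=> //.
  by rewrite -{1}[rcons _ t]cats0 eqseq_cat // eqxx /=; case: (v).
by apply/eqP => /(congr1 size)/eqP; rewrite !size_rcons eqn_leq ltnn.
Qed.

Lemma commg_u p q : reduced q -> p != [::] -> prefix p q -> p != q ->
  ([~ u p, u q] = if comm (join p q) then u (rcons p t) else 1)%g.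
Proof.
move=> rq p0 pq npq.
by rewrite -[RHS](mulKg (u q * u p)%g) -u_u // invgM /commg /conjg !mulgA.
Qed.

Lemma commg_avoid p q g h : reduced q -> p != [::] -> prefix p q -> p != q ->
  rootgrp (avoid p) g -> rootgrp (avoid q) h ->
  [~ g, h]%g = 1%g \/
  exists2 C, open_interval S (avoid p) (avoid q) C & rootgrp C [~ g, h]%g.
Proof.
move=> rq p0 pq npq; have q0 : q != [::] by case: p p0 pq npq => // ? ?; case: (q).
have rp := reduced_prefix pq rq.
rewrite !rootgrp_avoid // => -[->|->] [->|->]; rewrite ?comm1g ?commg1; [by left..|].
rewrite commg_u //; case: ifP => [cpq|_]; last by left.
right; have [pre ne1 ne2] := comm_join p0 pq cpq.
have rpt := reduced_prefix pre rq.
have pt0 : rcons p t != [::] by case: (p).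
exists (avoid (rcons p t)); last by rewrite rootgrp_avoid //; right.
split; last first.
  by case=> /avoid_inj e; [move: ne2|move: ne1]; rewrite e // eqxx.
apply: between_interval.
- by case: (pos_avoid rq q0).
- by case: (pos_avoid rpt pt0).
- by apply: avoid_sub; apply: prefix_rcons.
- exact: avoid_sub.
Qed.

(** Some w makes both roots positive; their words are then nested and [commg_avoid] applies.
    Conjugation by the lift of w carries the result back. *)
Lemma commg_root A B g h : prenilpotent S A B -> A <> B ->
  rootgrp A g -> rootgrp B h ->
  [~ g, h]%g = 1%g \/ exists2 C, open_interval S A B C & rootgrp C [~ g, h]%g.
Proof.
move=> prn; case: (prn) => [[rA rB] [w [/root_posP[p [rp p0 eA]] /root_posP[q [rq q0 eB]]]] _] nAB Ag Bh.
have npq : p != q.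
  by apply/eqP => e; apply: nAB; apply: (@translate_inj _ w); rewrite eA eB e.
have pre : prefix p q || prefix q p.
  apply: prenilpotent_avoid; rewrite -eA -eB; case: prn => _ _ [w' [nA nB]].
  split; first by split; apply: roots_translate.
    exists 1%g; rewrite !translate1 eA eB; split; exact: pos_avoid.
  by exists (w' * w^-1)%g; rewrite -!translateM mulgVK.
have Ag' := rootgrp_conj w rA Ag; have Bh' := rootgrp_conj w rB Bh.
rewrite eA in Ag'; rewrite eB in Bh'.
pose cj := fun g => (nw w * g * (nw w)^-1)%g.
have cjM (x y : G) : cj (x * y)%g = (cj x * cj y)%g by rewrite /cj !mulgA mulgVK.
suff : cj [~ g, h]%g = 1%g \/
    exists2 C, open_interval S (avoid p) (avoid q) C & rootgrp C (cj [~ g, h]%g).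
  have cjK (x : G) : ((nw w)^-1 * cj x * nw w = x)%g by rewrite /cj !mulgA mulVg mul1g mulgVK.
  case=> [e|[C hC Cgh]].
    by left; rewrite -[LHS]cjK e mulg1 mulVg.
  right; exists (translate w^-1%g C).
    rewrite -[A](translateK w) -[B](translateK w) eA eB.
    exact: open_interval_translate.
  have := @rootgrp_conj w^-1%g C _ _ Cgh.
  by rewrite (morphV nwM) invgK cjK; apply; case: hC => -[].
rewrite (morphR cjM); case/orP: pre => [pq|qp]; first exact: commg_avoid.
(* If q is the shorter word, the commutator is inverted. *)
have [] := @commg_avoid q p _ _ rp q0 qp _ Bh' Ag'; first by rewrite eq_sym.
  by rewrite -commgV => e; left; rewrite -[LHS]invgK e invg1.
move=> [C hC Cgh]; right; exists C; first exact: open_intervalC.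
by rewrite -commgV; have [_ _ +] := rootgrp_subgroup (proj1 (proj1 hC)); apply.
Qed.

(** The element n_a u_a n_a generates the root group of -alpha_a, so this writes n_a as the product
    u' u u'' asked for in RGD2. *)
Lemma n_decomp a :
  (n a = (n a * u [:: a] * n a) * u [:: a] * (n a * u [:: a] * n a))%g.
Proof.
rewrite -{1}braid -!mulgA.
rewrite [(u [:: a] * (u [:: a] * _))%g]mulgA u_sqr // mul1g.
by rewrite [(n a * (n a * _))%g]mulgA n_sqr mul1g mulgA u_sqr // mul1g.
Qed.

Lemma word_rgd : rgd_axioms S rootgrp.
Proof.
split; first exact: rootgrp_subgroup.
split.
- move=> _ [x [_ [[a _ <-] ->]]]; rewrite rootgrp_root => e.
  have : [set 1%g; rt x a] (rt x a) by right.
  by rewrite e => /= /rt_neq1.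
- move=> A B prn nAB; apply: gen_sub; first exact: gen_subgroup.
  move=> _ [g Ag [h Bh <-]].
  have [->|[C hC Cgh]] := commg_root prn nAB Ag Bh.
    by case: (gen_subgroup (\bigcup_(C in open_interval S A B) rootgrp C)).
  by apply: sub_gen; exists C.
- move=> _ v [a _ <-]; rewrite -[simple_root S (letter a)]translate1 -translateC.
  rewrite rootgrp_root => -[//|ev] _.
  have ev' : v = u [:: a] by rewrite ev /rt nw1 mul1g invg1 mulg1.
  have nun : rootgrp (translate 1 (~` simple_root S (letter a))) (n a * u [:: a] * n a)%g.
    rewrite translate1 simple_root_letter -translate_letter_same -simple_root_letter rootgrp_root.
    by right; rewrite /rt nw_gen nV.
  exists (n a * u [:: a] * n a)%g, (n a * u [:: a] * n a)%g; split=> // B rB.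
  by rewrite ev' -n_decomp -nw_gen conj_rootgrp.
(* RGD3: the group U_+ is contained in F, whereas n_a u_a n_a is not in F. *)
- move=> _ [a _ <-] h; apply: (@F_n a).
  have : gen_roots rootgrp (pos_root S) `<=` F.
    apply: gen_sub => // g [A /root_posP[p [rp p0 ->]]].
    rewrite rootgrp_avoid // => -[->|->]; last exact: F_u.
    by case: F_subgroup.
  apply; apply: h.
  rewrite simple_root_letter -translate_letter_same -simple_root_letter rootgrp_root.
  by right; rewrite /rt nw_gen nV.
(* RGD4 holds with h = 1: G is generated by the u_a and n_a, and [n_decomp] writes n_a as a product
   of root group elements. *)
- move=> g; exists 1%g, g; rewrite mul1g; split=> //.
    move=> A rA; rewrite /normalizer /= -nw1 conj_rootgrp // translate1 //.
  have : [set: G] g by [].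
  have [h1 hM hV] := gen_subgroup (\bigcup_(C in roots S) rootgrp C).
  have rtin x a : gen_roots rootgrp (roots S) (rt x a).
    apply: sub_gen; exists (translate x (simple_root S (letter a))).
      by exists x, (letter a); split=> //; exists a.
    by rewrite rootgrp_root; right.
  have uin a : gen_roots rootgrp (roots S) (u [:: a]).
    by have := rtin 1%g a; rewrite /rt nw1 mul1g invg1 mulg1.
  rewrite -G_gen; apply: (@gen_sub _ _ (gen_roots rootgrp (roots S))) => //.
  move=> _ [[a _ <-]//|[a _ <-]].
  have nun := rtin (letter a) a; rewrite /rt nw_gen nV in nun.
  by rewrite n_decomp; exact: (hM _ _ (hM _ _ nun (uin a)) nun).
Qed.

End WordRGD.

(** * The group acting on chambers *)

Section Bijections.
Variable T : Type.

(** The inverse is kept as data to make the group operations explicit; a bijection is still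
    determined by its forward map. *)
Record bijection := Bijection {
  fwd :> T -> T; bwd : T -> T; fwdK : cancel fwd bwd; bwdK : cancel bwd fwd }.
HB.instance Definition _ := gen_eqMixin bijection.
HB.instance Definition _ := gen_choiceMixin bijection.

Implicit Types f g h : bijection.

Lemma bijection_eq f g : f =1 g -> f = g.
Proof.
case: f g => f f' fK f'K [g g' gK g'K] /= /funext fg; subst g.
have e : f' = g' by apply/funext => x; rewrite -[x in LHS]g'K fK.
by subst g'; congr Bijection; apply: Prop_irrelevance.
Qed.

Definition bij1 : bijection := @Bijection id id (fun=> erefl) (fun=> erefl).
Definition bijM f g : bijection :=
  Bijection (can_comp (fwdK f) (fwdK g)) (can_comp (bwdK g) (bwdK f)).
Definition bijV f : bijection := Bijection (bwdK f) (fwdK f).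

Fact bijMA : associative bijM. Proof. by move=> f g h; apply: bijection_eq. Qed.
Fact bij1M : left_id bij1 bijM. Proof. by move=> f; apply: bijection_eq. Qed.
Fact bijM1 : right_id bij1 bijM. Proof. by move=> f; apply: bijection_eq. Qed.
Fact bijVM : left_inverse bij1 bijV bijM.
Proof. by move=> f; apply: bijection_eq => x /=; rewrite fwdK. Qed.
Fact bijMV : right_inverse bij1 bijV bijM.
Proof. by move=> f; apply: bijection_eq => x /=; rewrite bwdK. Qed.

HB.instance Definition _ := isGroup.Build bijection bijMA bij1M bijM1 bijVM bijMV.

End Bijections.

Section SubgroupType.
Variables (G : groupType) (A : set G) (hA : subgroup A).

Record subgroup_type := SubgroupElt { elt : G; eltP : A elt }.
(** The proof [hA] is a parameter of the type, so that the group structure depending on it can be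
    attached. *)
Definition subgroup_of of subgroup A := subgroup_type.
Local Notation H := (subgroup_of hA).
HB.instance Definition _ := gen_eqMixin H.
HB.instance Definition _ := gen_choiceMixin H.

Lemma elt_inj : injective (elt : H -> G).
Proof.
by move=> [x Ax] [y Ay] /= xy; subst y; congr SubgroupElt; apply: Prop_irrelevance.
Qed.

Let one : H := let: And3 h _ _ := hA in SubgroupElt h.
Let mul (x y : H) : H := let: And3 _ h _ := hA in SubgroupElt (h _ _ (eltP x) (eltP y)).
Let inv (x : H) : H := let: And3 _ _ h := hA in SubgroupElt (h _ (eltP x)).
Fact elt1_ : elt one = 1%g. Proof. by rewrite /one; case: hA. Qed.
Fact eltM_ x y : elt (mul x y) = (elt x * elt y)%g. Proof. by rewrite /mul; case: hA. Qed.
Fact eltV_ x : elt (inv x) = (elt x)^-1%g. Proof. by rewrite /inv; case: hA. Qed.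
Fact sub_mulA : associative mul.
Proof. by move=> x y z; apply: elt_inj; rewrite !eltM_ mulgA. Qed.
Fact sub_mul1 : left_id one mul.
Proof. by move=> x; apply: elt_inj; rewrite !eltM_ elt1_ mul1g. Qed.
Fact sub_1mul : right_id one mul.
Proof. by move=> x; apply: elt_inj; rewrite !eltM_ elt1_ mulg1. Qed.
Fact sub_mulV : left_inverse one inv mul.
Proof. by move=> x; apply: elt_inj; rewrite !eltM_ elt1_ eltV_ mulVg. Qed.
Fact sub_Vmul : right_inverse one inv mul.
Proof. by move=> x; apply: elt_inj; rewrite !eltM_ elt1_ eltV_ mulgV. Qed.
HB.instance Definition _ := isGroup.Build H sub_mulA sub_mul1 sub_1mul sub_mulV sub_Vmul.

Lemma elt1 : elt (1%g : H) = 1%g. Proof. exact: elt1_. Qed.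
Lemma eltM (x y : H) : elt (x * y)%g = (elt x * elt y)%g. Proof. exact: eltM_. Qed.

(** The default value 1 outside A makes this total, so that [root_elt] is defined on all words,
    reduced or not. *)
Definition to_sub (x : G) : H :=
  if pselect (A x) is left Ax then SubgroupElt Ax else 1%g.

Lemma to_subK x : A x -> elt (to_sub x) = x.
Proof. by rewrite /to_sub; case: pselect. Qed.

End SubgroupType.

(** * The RGD system of the chamber action *)

Section ChamberRGD.
Variables (L : choiceType) (t : L) (comm : pred (seq L)).
Hypothesis commP : admissible t comm.

Local Notation chambers := {w : seq (L * bool) | chamber w}.

Definition lift_act p (w : chambers) : chambers :=
  exist _ (act comm p (val w)) (chamber_act comm p (valP w)).
Definition lift_flip a (w : chambers) : chambers :=
  exist _ (flip comm a (val w)) (chamber_flip comm a (valP w)).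

Lemma lift_actK p : cancel (lift_act p) (lift_act p).
Proof. by move=> w; apply: val_inj; apply: (actK commP). Qed.

Lemma lift_flipK a : cancel (lift_flip a) (lift_flip a).
Proof. by move=> w; apply: val_inj; apply/(flipK commP)/valP. Qed.

Definition bact p : bijection chambers := Bijection (lift_actK p) (lift_actK p).
Definition bflip a : bijection chambers := Bijection (lift_flipK a) (lift_flipK a).

Definition rgd_group_set : set (bijection chambers) :=
  gen (range (fun a => bact [:: a]) `|` range bflip).

Lemma rgd_group_setP : subgroup rgd_group_set.
Proof. exact: gen_subgroup. Qed.

Definition rgd_group : groupType := subgroup_of rgd_group_setP.
Definition root_elt p : rgd_group := to_sub rgd_group_setP (bact p).
Definition refl_elt a : rgd_group := to_sub rgd_group_setP (bflip a).

Lemma bact_cons a p : reduced (a :: p) -> p != [::] ->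
  (bflip a * bact p * bflip a)%g = bact (a :: p).
Proof.
rewrite reduced_cons => /andP[pa rp] p0; apply: bijection_eq => w.
apply: val_inj; rewrite /= (flip_act commP) ?(flipK commP) ?chamber_flip //; exact: valP.
Qed.

Lemma bflip_in a : rgd_group_set (bflip a).
Proof. by apply: sub_gen; right; exists a. Qed.

Lemma bact_in p : reduced p -> p != [::] -> rgd_group_set (bact p).
Proof.
elim: p => // a p IH rap _; have [->|p0] := eqVneq p [::].
  by apply: sub_gen; left; exists a.
rewrite -bact_cons //; have [_ hM _] := rgd_group_setP.
have rp : reduced p by move: rap; rewrite reduced_cons => /andP[].
by apply: (hM) (bflip_in a); apply: (hM) (bflip_in a) (IH rp p0).
Qed.

Lemma elt_root p : reduced p -> p != [::] -> elt (root_elt p) = bact p.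
Proof. by move=> rp p0; apply: to_subK; apply: bact_in. Qed.

Lemma elt_refl a : elt (refl_elt a) = bflip a.
Proof. by apply: to_subK; apply: bflip_in. Qed.

Definition base_chamber : chambers := exist _ [::] isT.

(** The subgroup F of the criterion: the empty word codes the chamber B, which is fixed by all
    positive root groups. *)
Definition base_stabilizer : set rgd_group :=
  [set g | (elt g : bijection _) base_chamber = base_chamber].

Definition chamber_rootgrp := rootgrp root_elt refl_elt.

Lemma root_elt_sqr a : (root_elt [:: a] * root_elt [:: a] = 1)%g.
Proof.
by apply: elt_inj; rewrite eltM elt1 elt_root //; apply/bijection_eq/lift_actK.
Qed.

Lemma refl_elt_sqr a : (refl_elt a * refl_elt a = 1)%g.
Proof. by apply: elt_inj; rewrite eltM elt1 elt_refl; apply/bijection_eq/lift_flipK. Qed.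

Lemma elt_braid a : (root_elt [:: a] * refl_elt a * root_elt [:: a] =
  refl_elt a * root_elt [:: a] * refl_elt a)%g.
Proof.
apply: elt_inj; rewrite !eltM elt_refl elt_root //.
by apply: bijection_eq => w; apply: val_inj; exact: (flip_braid comm a (valP w)).
Qed.

Lemma root_elt_cons a p : reduced (a :: p) -> p != [::] ->
  (refl_elt a * root_elt p * refl_elt a = root_elt (a :: p))%g.
Proof.
move=> rap p0; have rp : reduced p by move: rap; rewrite reduced_cons => /andP[].
by apply: elt_inj; rewrite !eltM elt_refl !elt_root // bact_cons.
Qed.

Lemma root_elt_comm p q : reduced q -> p != [::] -> prefix p q -> p != q ->
  (root_elt p * root_elt q =
   root_elt q * root_elt p * (if comm (join p q) then root_elt (rcons p t) else 1))%g.
Proof.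
move=> rq p0 pq npq; have q0 : q != [::] by case: p p0 pq npq => // ? ?; case: (q).
have rp := reduced_prefix pq rq; apply: elt_inj; rewrite !eltM !elt_root //.
apply: bijection_eq => w; apply: val_inj; rewrite /= (act_comm commP) //.
case: ifP => [cpq|_] /=; last by rewrite elt1.
have [pre _ _] := comm_join commP p0 pq cpq.
by rewrite elt_root ?(reduced_prefix pre) //; case: (p).
Qed.

Lemma base_stabilizer_subgroup : subgroup base_stabilizer.
Proof.
rewrite /base_stabilizer; split=> /= [|g h gb hb|g gb]; first by rewrite elt1.
  by rewrite eltM /= hb.
have : elt (g^-1 * g)%g base_chamber = base_chamber by rewrite mulVg elt1.
by rewrite eltM /= gb.
Qed.

Lemma root_elt_stabilizer p : reduced p -> p != [::] -> base_stabilizer (root_elt p).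
Proof.
by move=> rp p0; rewrite /base_stabilizer /= elt_root //; apply: val_inj; exact: act_nil.
Qed.

(** The empty word is sent by n_a to [(a, false)], then by u_a to [(a, true)], which n_a fixes. *)
Lemma refl_elt_stabilizer a :
  ~ base_stabilizer (refl_elt a * root_elt [:: a] * refl_elt a)%g.
Proof.
rewrite /base_stabilizer /= !eltM elt_refl elt_root // => /(congr1 val) /=.
by rewrite act1_same /= eqxx.
Qed.

Lemma rgd_group_gen :
  gen (range (fun a => root_elt [:: a]) `|` range refl_elt) = [set: rgd_group].
Proof.
apply/seteqP; split=> // g _.
set K := gen _; have Kgr : subgroup K by exact: gen_subgroup.
suff : rgd_group_set `<=` (fun h : rgd_group => elt h) @` K.
  by move=> /(_ _ (eltP g)) [h Kh /(@elt_inj _ _ rgd_group_setP) <-].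
apply: gen_sub; first exact/(morph_image_subgroup (@eltM _ _ rgd_group_setP)).
move=> _ [[a _ <-]|[a _ <-]].
  by exists (root_elt [:: a]); rewrite ?elt_root //; apply: sub_gen; left; exists a.
by exists (refl_elt a); rewrite ?elt_refl //; apply: sub_gen; right; exists a.
Qed.

Lemma chamber_rgd : rgd_axioms (@letters_set L) chamber_rootgrp.
Proof.
exact: (word_rgd commP root_elt_sqr refl_elt_sqr elt_braid root_elt_cons root_elt_comm
  base_stabilizer_subgroup root_elt_stabilizer refl_elt_stabilizer rgd_group_gen).
Qed.

End ChamberRGD.

Arguments root_elt {L t comm} commP p.
Arguments refl_elt {L t comm} commP a.
Arguments chamber_rootgrp {L t comm} commP _.

Local Open Scope ring_scope.

(** * Root bases associated with W *)

Section FiniteOrder.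
Variables (R : realType) (k : nat).
Hypothesis k3 : (3 <= k)%N.

Local Notation th := (2 * (pi / k%:R) : R).

Lemma th_bounds : 0 < th < pi.
Proof.
have k0 : 0 < k%:R :> R by rewrite ltr0n (leq_trans _ k3).
have k3' : 3 <= k%:R :> R by rewrite (ler_nat R 3).
have := pi_gt0 R => p0; rewrite mulrA; apply/andP; split.
  by rewrite divr_gt0 // mulr_gt0.
by rewrite ltr_pdivrMr //; nra.
Qed.

Lemma cos_sqr_th : 4 * cos (pi / k%:R) ^+ 2 = 2 * cos th + 2 :> R.
Proof.
have -> : th = pi / k%:R + pi / k%:R by ring.
by rewrite cosD -!expr2 sin2cos2; ring.
Qed.

(** With phi the angle, sin phi z_n = sin (n phi) z_1 - sin ((n - 1) phi) z_0. For n = k the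
    multiple n phi is 2 pi, and sin phi is nonzero because k >= 3. *)
Lemma chebyshev_periodic (z : nat -> R) :
  (forall n, z n.+2 = 2 * cos th * z n.+1 - z n) -> z k = z 0%N.
Proof.
have := th_bounds; set phi := th => /andP[th0 thpi] zrec.
have k0 : k%:R != 0 :> R by rewrite pnatr_eq0 -lt0n (leq_trans _ k3).
have s0 : sin phi != 0 by rewrite gt_eqF // sin_gt0_pi // th0.
suff zsin n : sin phi * z n = sin (phi * n%:R) * z 1%N - sin (phi * n%:R - phi) * z 0%N.
  have e : phi * k%:R = pi *+ 2.
    by rewrite /phi -mulrA [_ / _ * _]mulrVK ?unitfE // mulr_natl.
  apply: (mulfI s0); rewrite zsin e sinB sin2pi cos2pi; ring.
suff [] : sin phi * z n = sin (phi * n%:R) * z 1%N - sin (phi * n%:R - phi) * z 0%N /\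
  sin phi * z n.+1 = sin (phi * n.+1%:R) * z 1%N - sin (phi * n.+1%:R - phi) * z 0%N by [].
elim: n => [|n [IH1 IH2]].
  by rewrite mulr0 sin0 mulr1 subrr sin0 sub0r sinN; split; ring.
split=> //; rewrite zrec mulrBr IH1 mulrCA -mulrA IH2.
rewrite -![n.+2%:R]natr1 -![n.+1%:R]natr1 !mulrDr !mulr1 !(sinB, sinD, cosD, cosB).
have := cos2Dsin2 phi => cs.
have {}cs : sin phi ^+ 2 = 1 - cos phi ^+ 2 by rewrite -cs; ring.
ring: cs.
Qed.

Variables (V : lmodType R) (a b : V) (f g : {scalar V}).
Hypotheses (faa : f a = 2) (gbb : g b = 2).

Definition rotation (v : V) : V := (v - g v *: b) - f (v - g v *: b) *: a.
Local Notation M := rotation.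

Lemma rotE v : M v = v + ((g v * f b - f v) *: a + (- g v) *: b).
Proof.
rewrite /rotation linearB [f (g v *: b)]linearZ /= -[- (g v *: b)]scaleNr -[- (_ *: a)]scaleNr opprB.
by rewrite -addrA [_ *: b + _]addrC.
Qed.

Lemma f_span x y : f (x *: a + y *: b) = 2 * x + y * f b.
Proof. by rewrite linearD [f (x *: a)]linearZ [f (y *: b)]linearZ /= faa mulrC. Qed.

Lemma g_span x y : g (x *: a + y *: b) = x * g a + 2 * y.
Proof. by rewrite linearD [g (x *: a)]linearZ [g (y *: b)]linearZ /= gbb [2 * _]mulrC. Qed.

Lemma rot_span x y : M (x *: a + y *: b) =
  (x * (f b * g a - 1) + y * f b) *: a + (- x * g a - y) *: b.
Proof.
rewrite rotE f_span g_span addrACA -!scalerDl.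
by congr (_ *: _ + _ *: _); ring.
Qed.

Hypothesis fg : g a * f b = 4 * cos (pi / k%:R) ^+ 2.

(** On coordinates the rotation is a matrix of determinant 1 and trace 2 cos th, so each coordinate
    satisfies the recurrence of [chebyshev_periodic]. *)
Lemma rot_iter_span x y : iter k M (x *: a + y *: b) = x *: a + y *: b.
Proof.
pose step (z : R * R) := (z.1 * (f b * g a - 1) + z.2 * f b, - z.1 * g a - z.2).
pose z n := iter n step (x, y).
have zM n : iter n M (x *: a + y *: b) = (z n).1 *: a + (z n).2 *: b.
  by elim: n => //= n ->; rewrite rot_span.
have fgc : f b * g a = 2 * cos th + 2 by rewrite mulrC fg cos_sqr_th.
rewrite zM; congr (_ *: _ + _ *: _); apply: (@chebyshev_periodic (fun n => _ (z n))) => n /=.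
  by rewrite /= mulrDr mulrBr; ring: fgc.
by ring: fgc.
Qed.

Lemma rot_iter v : iter k M v = v.
Proof.
have := th_bounds; set phi := th => /andP[th0 thpi].
pose D := 4 - g a * f b.
have D0 : D != 0.
  have c1 : cos phi < 1 by rewrite -cos0 ltr_cos // ?in_itv /=; lra.
  by rewrite /D fg cos_sqr_th -/phi; apply/eqP; lra.
(* Cramer's rule: f and g take the same values on u as on v, so the rotation fixes v - u. *)
pose x := (2 * f v - f b * g v) / D; pose y := (2 * g v - g a * f v) / D.
pose u := x *: a + y *: b.
have fw : f (v - u) = 0.
  by rewrite linearB f_span /x /y /D; field; exact: D0.
have gw : g (v - u) = 0.
  by rewrite linearB g_span /x /y /D; field; exact: D0.
have MW n v' w : f w = 0 -> g w = 0 -> iter n M (v' + w) = iter n M v' + w.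
  move=> {}fw {}gw; elim: n => //= n ->.
  by rewrite !rotE [g (_ + w)]linearD [f (_ + w)]linearD fw gw !addr0 addrAC.
by rewrite -{1}(subrKC u v) MW // rot_iter_span subrKC.
Qed.

End FiniteOrder.

(** * Root bases of free products of groups of order two *)

Section UniversalRootBasis.
Variables (R : realType) (L : finType) (B : root_basis R).
Local Notation V := (rb_V B).
Local Notation S := (@letters_set L).
Variable rho : word L -> V -> V.
Hypothesis rhoM : forall x y, rho (x * y)%g = rho x \o rho y.
Hypothesis rho_bij : set_bij [set: word L] (@rb_W R B) rho.
Hypothesis rhoS_bij : set_bij S (@rb_S R B) rho.

Lemma rho_inj : injective rho.
Proof. by move=> x y xy; have [_ inj _] := rho_bij; apply: inj; rewrite ?in_setT. Qed.

Lemma rb_coroot2 (v : V) : rb_Pi v -> rb_coroot v v = 2.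
Proof. by move=> Pv; have [_ h _ _] := rb_ax B; apply: h. Qed.

Lemma reflK (v : V) : rb_Pi v -> involutive (refl v).
Proof.
move=> Pv w; rewrite /refl linearB [rb_coroot v (_ *: v)]linearZ /= rb_coroot2 //.
set c := rb_coroot v w; have -> : c - c * 2 = - c by ring.
by rewrite scaleNr opprK subrK.
Qed.

Lemma refl_self (v : V) : rb_Pi v -> refl v v = - v.
Proof. by move=> Pv; rewrite /refl rb_coroot2 // scaler_nat mulr2n opprD addrA subrr add0r. Qed.

Lemma refl_linear (v : V) x y a b : refl v (a *: x + b *: y) = a *: refl v x + b *: refl v y.
Proof.
rewrite /refl linearD [rb_coroot v (a *: x)]linearZ [rb_coroot v (b *: y)]linearZ /=.
by rewrite !scalerBr !scalerA scalerDl opprD addrACA.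
Qed.

Lemma simple_vectors : exists e : L -> V,
  forall a, rb_Pi (e a) /\ rho (letter a) = refl (e a).
Proof.
suff /choice[e he] : forall a, exists v, rb_Pi v /\ rho (letter a) = refl v by exists e.
move=> a; have [sub _ _] := rhoS_bij.
by have [|v Pv ev] := sub (letter a); [exists a|exists v].
Qed.

Variable e : L -> V.
Hypothesis ePi : forall a, rb_Pi (e a).
Hypothesis rho_letter : forall a, rho (letter a) = refl (e a).

Lemma rho_mul x y v : rho (x * y)%g v = rho x (rho y v).
Proof. by rewrite rhoM. Qed.

Lemma rho1 v : rho 1%g v = v.
Proof.
have [[v0 Pv0] _ _ _] := rb_ax B.
have [_ _ sur] := rhoS_bij; have [|_ [a _ <-] ea] := sur (refl v0); first by exists v0.
by rewrite -(letterK a) rho_mul ea reflK.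
Qed.

Lemma rho_linear x v w a b : rho x (a *: v + b *: w) = a *: rho x v + b *: rho x w.
Proof.
elim/word_ind: x => [|i x _ IH]; first by rewrite !rho1.
by rewrite !rho_mul IH rho_letter refl_linear.
Qed.

Lemma rhoN x v : rho x (- v) = - rho x v.
Proof.
by have := rho_linear x v 0 (-1) 0; rewrite !scaleN1r !scale0r !addr0.
Qed.

Lemma rho_sum x (c : L -> R) (v : L -> V) :
  rho x (\sum_i c i *: v i) = \sum_i c i *: rho x (v i).
Proof.
rewrite (big_morph (rho x) (id1 := 0) (op1 := +%R)) //.
- by apply: eq_bigr => i _; have := rho_linear x (v i) 0 (c i) 0; rewrite !scale0r !addr0.
- by move=> y z; have := rho_linear x y z 1 1; rewrite !scale1r.
- by have := rho_linear x 0 0 0 0; rewrite !scale0r !addr0.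
Qed.

Lemma rb_WP (w : V -> V) : rb_W w -> exists x, w = rho x.
Proof. by have [_ _ sur] := rho_bij; move=> /sur[x _ <-]; exists x. Qed.

Variable f : {scalar V}.
Hypothesis f_gt0 : forall v, rb_Pi v -> 0 < f v.

(* Distinct simple vectors with the same reflection would be positively
   proportional, against [rb_coroot] being nonpositive on them. *)
Lemma simple_vector_of v : rb_Pi v -> exists a, v = e a.
Proof.
move=> Pv; have [_ _ sur] := rhoS_bij.
have [|_ [a _ <-] ea] := sur (refl v); first by exists v.
exists a; apply: contrapT => nva; rewrite rho_letter in ea.
have cle : rb_coroot (e a) v <= 0.
  have [_ _ h _] := rb_ax B; case: (h v (e a) Pv (ePi a) nva) => [[-> _]|[/ltW]//].
  by rewrite lexx.
have := congr1 (fun r => f (r v)) ea; rewrite /refl rb_coroot2 // !linearB.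
rewrite [f (2 *: v)]linearZ [f (_ *: e a)]linearZ /=.
have := f_gt0 Pv; have := f_gt0 (ePi a) => fe fv; nra.
Qed.

Lemma e_inj : injective e.
Proof.
move=> a b eab; apply: letter_inj; apply: rho_inj.
by rewrite !rho_letter eab.
Qed.

Definition neg_cartan a b : R := - rb_coroot (e a) (e b).
Local Notation K := neg_cartan.

Lemma letters_expg a b n : a != b ->
  @letters L ((letter a * letter b) ^+ n)%g = flatten (nseq n [:: a; b]).
Proof.
move=> nab; elim: n => // n IH; rewrite expgS -mulgA !letter_mul IH.
case: n {IH} => [|n] /=; first by rewrite eq_sym (negPf nab).
by rewrite (negPf nab) /= eq_sym (negPf nab).
Qed.

Lemma rho_expg x n v : rho (x ^+ n)%g v = iter n (rho x) v.
Proof. by elim: n => [|n IH]; rewrite ?rho1 // expgS rho_mul IH. Qed.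

(** In W the product ab has infinite order. The other values allowed by RB2 would make it finite:
    orthogonal vectors have commuting reflections, and for 4 cos^2 (pi / k) with k >= 3 the k-th
    power is trivial by [rot_iter]. *)
Lemma K_bounds a b : a != b -> 0 < K a b /\ 4 <= K a b * K b a.
Proof.
move=> nab; have nab' : e a <> e b by move=> /e_inj/eqP; apply/negP.
have nontriv n : (0 < n)%N -> ~ forall v, iter n (refl (e a) \o refl (e b)) v = v.
  move=> n0 h; have : ((letter a * letter b) ^+ n = 1)%g.
    apply: rho_inj; apply/funext => v; rewrite rho_expg rho1 -[RHS]h.
    by apply: eq_iter => w; rewrite /= rho_mul !rho_letter.
  move/(congr1 (@letters L)); rewrite letters_expg //.
  by case: n n0 {h}.
rewrite /neg_cartan mulrNN; have [_ _ h _] := rb_ax B.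
case: (h (e a) (e b) (ePi a) (ePi b) nab') => [[c0 c1]|[c0 c1 c2]].
  case: (@nontriv 2%N) => // v /=.
  have rab w : refl (e a) (refl (e b) w) = w - rb_coroot (e b) w *: e b - rb_coroot (e a) w *: e a.
    by rewrite /refl linearB [rb_coroot (e a) (_ *: e b)]linearZ /= c1 mulr0 subr0.
  have rba w : refl (e b) (refl (e a) w) = refl (e a) (refl (e b) w).
    by rewrite rab /refl linearB [rb_coroot (e b) (_ *: e a)]linearZ /= c0 mulr0 subr0 addrAC.
  by rewrite rba !reflK.
split; first by rewrite oppr_gt0.
case: c2 => [[k k1 ck]|]; last by rewrite mulrC.
have cp : 0 < rb_coroot (e b) (e a) * rb_coroot (e a) (e b) by rewrite nmulr_rgt0.
(* For k = 1 the product is 4, and k = 2 would make it 0. *)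
move: k1 ck; case: k => [//|[|[|k]]] _ ck.
- by rewrite mulrC ck divr1 cospi sqrrN expr1n mulr1.
- by move: cp; rewrite ck cos_pihalf expr0n /= mulr0 ltxx.
case: (@nontriv k.+3) => // v.
by rewrite -[RHS](@rot_iter R k.+3 _ V (e a) (e b) (rb_coroot (e a)) (rb_coroot (e b)) _ _ ck) ?rb_coroot2.
Qed.

Lemma refl_e a b : refl (e a) (e b) = e b + K a b *: e a.
Proof. by rewrite /refl /neg_cartan scaleNr. Qed.

(* The coefficient of the leading letter [h] stays dominant: applying [letter i],
   [i <> h], replaces [c i] by a number at least [K i h * c h / 2], because
   [4 <= K i h * K h i]. *)
Lemma root_coef (x : word L) a : reduced (rcons x a) -> exists c : L -> R,
  [/\ rho x (e a) = \sum_i c i *: e i, forall i, 0 <= c i,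
      0 < c (head a (letters x)) & forall j, j != head a (letters x) -> 2 * c j <= K j (head a (letters x)) * c (head a (letters x))].
Proof.
elim/word_ind: x => [_|i x hi IH].
  exists (fun j => (j == a)%:R); split=> /=.
  - by rewrite rho1 (bigD1 a) //= eqxx scale1r big1 ?addr0 // => j /negPf->; rewrite scale0r.
  - by move=> j; rewrite ler0n.
  - by rewrite eqxx.
  - move=> j nja; rewrite eqxx (negPf nja) mulr0 mulr1.
    by have [/ltW] := K_bounds nja.
rewrite letter_mul push_id // rcons_cons reduced_cons => /andP[hia rxa].
have [c [ec c0 ch cd]] := IH rxa; set h := head a (letters x) in ch cd.
have nih : i != h.
  by move: hia; rewrite /h; case: (letters x) => [|b q] /=; rewrite eq_sym.
(* The reflection of the letter i changes only the coefficient of e_i, which becomes [ci]. *)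
pose ci := - c i + \sum_(j | j != i) c j * K i j.
have ciE : ci = c h * K i h - c i + \sum_(j | (j != i) && (j != h)) c j * K i j.
  by rewrite /ci (bigD1 h) 1?eq_sym //=; ring.
have cK j : j != i -> 0 <= c j * K i j.
  by rewrite eq_sym => nij; rewrite mulr_ge0 //; have [/ltW] := K_bounds nij.
have [Kih KK] := K_bounds nih; have Khi : 0 < K h i by have [] := @K_bounds h i; rewrite // eq_sym.
have cih : c h * K i h <= 2 * ci.
  have := cd i nih; rewrite ciE.
  have : 0 <= \sum_(j | (j != i) && (j != h)) c j * K i j.
    by apply: sumr_ge0 => j /andP[nji _]; apply: cK.
  by set s := \sum_(j | _) _; lra.
have chK : 0 < c h * K i h by rewrite mulr_gt0.
have ci0 : 0 < ci by lra.
exists (fun j => if j == i then ci else c j); split=> /=.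
- rewrite rho_mul ec rho_sum rho_letter (bigD1 i) //= [RHS](bigD1 i) //= eqxx refl_self //.
  rewrite (eq_bigr (fun j => c j *: e j + (c j * K i j) *: e i)); last first.
    by move=> j _; rewrite refl_e scalerDr scalerA.
  rewrite big_split /= -scaler_suml scalerN addrCA addrC -scaleNr -scalerDl -/ci.
  by congr (_ + _); apply: eq_bigr => j /negPf->.
- by move=> j; case: eqP => // _; apply: ltW.
- by rewrite eqxx.
move=> j nji; rewrite eqxx (negPf nji).
(* For j = h: 4 c_h <= K h i K i h c_h <= 2 K h i [ci]. *)
have [->|njh] := eqVneq j h; first by nra.
have nij : i != j by rewrite eq_sym.
have [Kij KKj] := K_bounds nij; have [Kji _] := K_bounds nji.
(* For the other j, multiplying this bound by K j i gains the factor 4. *)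
have cij : c j * K i j <= ci.
  have := cd i nih; rewrite ciE (bigD1 j) ?nji //=.
  have : 0 <= \sum_(l | (l != i) && (l != h) && (l != j)) c l * K i l.
    by apply: sumr_ge0 => l /andP[/andP[nli _] _]; apply: cK.
  by set s := \sum_(l | _) _; lra.
have : 0 <= (K i j * K j i - 4) * c j by rewrite mulr_ge0 // subr_ge0.
have : 0 <= K j i * (ci - c j * K i j) by rewrite mulr_ge0 // ?subr_ge0 // ltW.
have := c0 j; nra.
Qed.

Lemma rho_root x a : rb_roots (rho x (e a)).
Proof.
exists (rho x), (e a); split=> //; have [sub _ _] := rho_bij.
by apply: (sub x).
Qed.

(** All coefficients are nonnegative and the leading one is positive. Together with [root_nreduced],
    the sign of f on a root tells whether it is positive. *)
Lemma root_reduced (x : word L) a : reduced (rcons x a) ->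
  rb_pos_roots (rho x (e a)) /\ 0 < f (rho x (e a)).
Proof.
move=> r; have [c [ec c0 ch _]] := root_coef r; split.
  split; first exact: rho_root.
  exists [seq (c i, e i) | i <- enum L]; split.
    by move=> _ /mapP[i _ ->]; split; [exact: c0|exact: ePi].
  by rewrite ec big_map big_enum.
rewrite ec linear_sum (bigD1 (head a (letters x))) //= [f (_ *: _)]linearZ ltr_pwDl //.
  by rewrite mulr_gt0 // f_gt0.
by apply: sumr_ge0 => i _; rewrite [f (_ *: _)]linearZ mulr_ge0 // ltW // f_gt0.
Qed.

Lemma root_nreduced (x : word L) a : ~~ reduced (rcons x a) -> f (rho x (e a)) < 0.
Proof.
case: (last_letterP x a) => [->//|y r -> _ _].
have [_ fy] := root_reduced r.
by rewrite rho_mul rho_letter refl_self // rhoN linearN oppr_lt0.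
Qed.

Lemma pos_root_ge0 v : rb_pos_roots v -> 0 <= f v.
Proof.
move=> [_ [s [hs ->]]]; rewrite linear_sum big_seq; apply: sumr_ge0 => p ps.
have [p0 Pp] := hs p ps.
by rewrite [f (_ *: _)]linearZ mulr_ge0 // ltW // f_gt0.
Qed.

Variables (S_neq0 : S !=set0) (G : groupType) (U : set (word L) -> set G).
Variable U_ax : rgd_axioms S U.
Local Notation D := (RGDSystem S_neq0 (@word_coxeter L) U_ax).
Local Notation halfspace := (@halfspace R D B rho).
Local Notation vector_of := (@vector_of R D B rho).

Lemma halfspaceE x a w : halfspace (rho x (e a)) w = reduced (rcons (w^-1 * x)%g a).
Proof.
have -> : halfspace (rho x (e a)) w = rb_pos_roots (rho (w^-1 * x)%g (e a)).
  by rewrite rho_mul.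
move: (w^-1 * x)%g => y; apply/propext.
have [r|nr] := boolP (reduced _); first by split=> // _; case: (root_reduced r).
by split=> // /pos_root_ge0; rewrite leNgt root_nreduced.
Qed.

Lemma halfspace_root x a :
  halfspace (rho x (e a)) = translate x (simple_root S (letter a)).
Proof.
apply/funext => w; rewrite halfspaceE translateE simple_root_letter.
rewrite -[(x^-1 * w)%g]invgK invgM invgK; move: (w^-1 * x)%g => y.
rewrite reduced_rcons wordP andbT /avoid /=.
by case: (rev y) => //= b q; rewrite prefix0s andbT eq_sym.
Qed.

Lemma vector_of_root x a :
  vector_of (translate x (simple_root S (letter a))) = rho x (e a).
Proof.
apply: xget_unique; first by split; [exact: rho_root|exact: halfspace_root].
move=> _ [[_ [_ [/rb_WP[y ->] /simple_vector_of[b ->] ->]]]].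
by rewrite halfspace_root => /root_inj[-> ->].
Qed.

Lemma f_root_lt0 x a w : ~ translate x (simple_root S (letter a)) w ->
  f (rho w^-1%g (rho x (e a))) < 0.
Proof.
rewrite -halfspace_root halfspaceE -rho_mul => /negP; exact: root_nreduced.
Qed.

(** An element w lies in a root iff f is positive on the translate of its vector by the inverse of
    w, and f is linear. For nested A and A' this puts C between them. *)
Lemma cone_interval A A' C x y : roots S A -> roots S A' -> roots S C ->
  0 <= x -> 0 <= y ->
  vector_of C = x *: vector_of A + y *: vector_of A' ->
  (A `&` A' `<=` C) /\ (C `<=` A `|` A').
Proof.
move=> [v [_ [[a _ <-] ->]]] [v' [_ [[b _ <-] ->]]] [v'' [_ [[c _ <-] ->]]] x0 y0.
rewrite !vector_of_root => e0.
have fe w : f (rho w^-1%g (rho v'' (e c))) =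
    x * f (rho w^-1%g (rho v (e a))) + y * f (rho w^-1%g (rho v' (e b))).
  rewrite e0 rho_linear linearD [f (x *: _)]linearZ [f (y *: _)]linearZ //.
split=> w.
  rewrite -!halfspace_root => -[/pos_root_ge0 h1 /pos_root_ge0 h2].
  rewrite halfspace_root; apply: contrapT => /f_root_lt0; rewrite fe.
  by apply/negP; rewrite -leNgt addr_ge0 // mulr_ge0.
move=> hC; apply: contrapT => /not_orP[/f_root_lt0 h1 /f_root_lt0 h2].
have : 0 < f (rho w^-1%g (rho v'' (e c))).
  move: hC; rewrite -halfspace_root halfspaceE -rho_mul => /root_reduced[]//.
by rewrite fe; nra.
Qed.

(* [avoid [:: s; t]] is the only root strictly between the two, and the
   vectors of these three roots are linearly independent. *)
Lemma open_lin_empty s t r : s != t -> t != r -> s != r ->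
  open_lin (D := D) rho (avoid [:: s]) (avoid [:: s; t; r]) `<=` set0.
Proof.
move=> nst ntr nsr C [[rC [x [y [x0 y0 eC]]]] /not_orP[nCs nCstr]].
have red_str : reduced [:: s; t; r] by rewrite /reduced /= nst ntr.
have red_st : reduced [:: s; t] by rewrite /reduced /= nst.
have es : avoid [:: s] = translate 1%g (simple_root S (letter s)).
  by rewrite root_pos.
have est : avoid [:: s; t] = translate (letter s) (simple_root S (letter t)).
  by rewrite root_pos.
have lst : letters (letter s * letter t)%g = [:: s; t].
  by rewrite letter_mul push_id //= eq_sym.
have estr : avoid [:: s; t; r] =
    translate (letter s * letter t)%g (simple_root S (letter r)).
  by rewrite root_pos lst.
have S_root z a : roots S (translate z (simple_root S (letter a))).
  by exists z, (letter a); split=> //; exists a.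
have [sC Cstr] : avoid [:: s] `<=` C /\ C `<=` avoid [:: s; t; r].
  have rs : roots S (avoid [:: s]) by rewrite es.
  have rstr : roots S (avoid [:: s; t; r]) by rewrite estr.
  have [h1 h2] := cone_interval rs rstr rC x0 y0 eC.
  have sub : avoid [:: s] `<=` avoid [:: s; t; r].
    by apply: avoid_sub; rewrite /= eqxx.
  split=> w hw; first by apply: h1; split=> //; apply: sub.
  by case: (h2 w hw) => // /sub.
have [g [rg g0 eg]] : exists g, [/\ reduced g, g != [::] & C = avoid g].
  by apply: root_posP; split=> //; apply: sC; apply: avoid1.
have {}sC : prefix [:: s] g by apply: avoid_subP => //; rewrite -eg.
have {}Cstr : prefix g [:: s; t; r] by apply: avoid_subP => //; rewrite -eg.
(* Among the nonempty prefixes of str, only st differs from both ends. *)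
have {}eg : C = avoid [:: s; t].
  move: Cstr; rewrite prefixE; case: (size g) => [|[|[|n]]] /= /eqP e';
    rewrite -e' in eg sC.
  - by [].
  - by case: nCs.
  - by [].
  - by case: nCstr.
(* After applying s, the relation reads e_t = - x e_s + y (e_r + K t r e_t). *)
move: eC; rewrite eg est es estr !vector_of_root !rho_mul rho1 => /(congr1 (rho (letter s))).
have letter2 v : rho (letter s) (rho (letter s) v) = v.
  by rewrite -rho_mul letterK rho1.
rewrite rho_linear !letter2 !rho_letter [refl (e t) (e r)]refl_e refl_self // => h.
have hf (g' : {scalar V}) : g' (e t) = - (x * g' (e s)) + y * (g' (e r) + K t r * g' (e t)).
  rewrite {1}h linearD [g' (x *: _)]linearZ [g' (y *: _)]linearZ /=.
  by rewrite linearN linearD [g' (K _ _ *: _)]linearZ /= mulrN.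
have [Kst _] := K_bounds nst.
have [Ksr _] := K_bounds nsr; have [Krs _] : 0 < K r s /\ 4 <= K r s * K s r.
  by apply: K_bounds; rewrite eq_sym.
have [Ktr _] := K_bounds ntr; have [Krt _] : 0 < K r t /\ 4 <= K r t * K t r.
  by apply: K_bounds; rewrite eq_sym.
have := hf (rb_coroot (e s)); have := hf (rb_coroot (e r)).
have -> : rb_coroot (e s) (e t) = - K s t by rewrite /neg_cartan opprK.
have -> : rb_coroot (e s) (e r) = - K s r by rewrite /neg_cartan opprK.
have -> : rb_coroot (e r) (e t) = - K r t by rewrite /neg_cartan opprK.
have -> : rb_coroot (e r) (e s) = - K r s by rewrite /neg_cartan opprK.
rewrite !rb_coroot2 //.
move=> er es'.
(* The coroot of e_s excludes y K t r >= 1 and that of e_r excludes y K t r < 1, because all the K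
   involved are positive. *)
have [ytr|ytr] := lerP 1 (y * K t r).
  have y_gt0 : 0 < y by rewrite -(pmulr_lgt0 _ Ktr) (lt_le_trans _ ytr).
  have := mulr_gt0 y_gt0 Ksr; have : 0 <= (y * K t r - 1) * K s t.
    by rewrite mulr_ge0 ?subr_ge0 // ltW.
  by lra.
have : 0 < (1 - y * K t r) * K r t by rewrite mulr_gt0 // subr_gt0.
by have := mulr_ge0 x0 (ltW Krs); lra.
Qed.

End UniversalRootBasis.

(** * Nonlinearizable systems *)

Section ChamberSystem.
Variables (L : finType) (t : L) (comm : pred (seq L)).
Hypothesis commP : admissible t comm.

Definition chamber_system : rgd_system :=
  RGDSystem (letters_set_neq0 t) (@word_coxeter L) (chamber_rgd commP).

Local Notation u := (root_elt commP).

Lemma chamber_rootgrp_avoid p : reduced p -> p != [::] ->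
  chamber_rootgrp commP (avoid p) = [set 1%g; u p].
Proof. exact: (rootgrp_avoid (refl_elt_sqr commP) (root_elt_cons commP)). Qed.

Lemma chamber_elt_neq1 p : reduced p -> p != [::] -> u p <> 1%g.
Proof.
exact: (u_neq1 (refl_elt_sqr commP) (root_elt_cons commP)
  (base_stabilizer_subgroup commP) (@refl_elt_stabilizer _ _ _ commP)).
Qed.

Lemma chamber_commg p q : reduced q -> p != [::] -> prefix p q -> p != q ->
  ([~ u p, u q] = if comm (join p q) then u (rcons p t) else 1)%g.
Proof. exact: (commg_u (root_elt_comm commP)). Qed.

(** Since u_{pt} is nontrivial, [comm] can be read off from the group. *)
Lemma chamber_commg_neq1 p q : reduced q -> p != [::] -> prefix p q -> p != q ->
  comm (join p q) <-> [~ u p, u q]%g <> 1%g.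
Proof.
move=> rq p0 pq npq; rewrite chamber_commg //; case: ifP => // cpq; split=> // _.
have [pre _ _] := comm_join commP p0 pq cpq.
by apply: chamber_elt_neq1; [exact: reduced_prefix pre rq|case: (p)].
Qed.

(** By [open_lin_empty], linearity would force u_s and u_{str} to commute, but their commutator is
    u_{st}. *)
Lemma chamber_not_linearizable (R : realType) s r :
  s != t -> t != r -> s != r -> comm [:: s; t; r] -> ~ linearizable R chamber_system.
Proof.
move=> nst ntr nsr cstr [B [rho [_ [rhoM bijW bijS] lin]]].
have [e he] := simple_vectors bijS.
have [_ _ _ [f f_gt0]] := rb_ax B.
have red_str : reduced [:: s; t; r] by rewrite /reduced /= nst ntr.
have pre : prefix [:: s] [:: s; t; r] by rewrite /= eqxx.
have neq : avoid [:: s] <> avoid [:: s; t; r] by move=> /(avoid_inj (isT : reduced [:: s]) red_str).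
have : [~ u [:: s], u [:: s; t; r]]%g = 1%g.
  apply: (@gen_set0 (rgd_group commP)).
  have := lin _ _ (prenilpotent_prefix (isT : reduced [:: s]) red_str isT pre) neq.
  have open0 : open_lin (D := chamber_system) rho (avoid [:: s]) (avoid [:: s; t; r]) = set0.
    apply/seteqP; split=> // C.
    apply: (open_lin_empty rhoM bijW bijS (fun a => proj1 (he a)) (fun a => proj2 (he a)) f_gt0) => //.
  rewrite open0 /gen_roots bigcup_set0; apply; apply: sub_gen.
  exists (u [:: s]); first by rewrite /= chamber_rootgrp_avoid //; right.
  by exists (u [:: s; t; r]) => //; rewrite /= chamber_rootgrp_avoid //; right.
have nstr : [:: s] != [:: s; t; r] by rewrite eqseq_cons eqxx.
have [ne _] := chamber_commg_neq1 red_str (isT : [:: s] != [::]) pre nstr.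
by move/(ne cstr).
Qed.

End ChamberSystem.

(** * Isomorphisms between chamber systems *)

Section Isomorphism.
Variables (L : finType) (t : L) (comm comm' : pred (seq L)).
Hypothesis commP : admissible t comm.
Hypothesis commP' : admissible t comm'.

(** As pi maps S onto S, it permutes the letters and maps the root of p to that of its image under
    sigma. Root groups have order two, so theta maps u_p to the element of the image word, and
    commutators correspond. *)
Lemma chamber_iso_comm :
  rgd_isomorphic (chamber_system commP) (chamber_system commP') ->
  exists2 sigma : L -> L, injective sigma & forall p q, reduced q -> p != [::] ->
    prefix p q -> p != q -> comm (join p q) = comm' (map sigma (join p q)).
Proof.
move=> [theta [pi [[theta_bij thetaM] [pi_bij piM] piS thetaU]]].
have theta_inj := bij_inj theta_bij; have pi_inj := bij_inj pi_bij.
have [sigma piE] : exists sigma : L -> L, forall a, pi (letter a) = letter (sigma a).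
  suff /choice[sigma h] : forall a, exists b, pi (letter a) = letter b by exists sigma.
  move=> a; have : (pi @` @rgd_S (chamber_system commP)) (pi (letter a)).
    by exists (letter a) => //; exists a.
  by rewrite piS => -[b _ <-]; exists b.
have sigma_inj : injective sigma.
  by move=> a b ab; apply/letter_inj/pi_inj; rewrite !piE ab.
have pi_letters (x : word L) : letters (pi x) = map sigma (letters x).
  elim/word_ind: x => [|a x _ IH]; first by rewrite (morph1 piM).
  rewrite piM piE !letter_mul IH; case: (letters x) => //= b p.
  by rewrite (inj_eq sigma_inj); case: eqP.
have pi_avoid p : pi @` avoid p = avoid (map sigma p).
  have pre_map (x : word L) : prefix (map sigma p) (pi x) = prefix p x.
    by rewrite pi_letters !prefixE size_map -map_take (inj_eq (inj_map sigma_inj)).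
  apply/seteqP; split=> [_ [x hx <-]|y hy]; first by rewrite /avoid /= pre_map.
  have [pi' piK pi'K] := pi_bij; exists (pi' y); last exact: pi'K.
  by move: hy; rewrite /avoid /= -{1}(pi'K y) pre_map.
have red_map p : reduced (map sigma p) = reduced p.
  rewrite /reduced sorted_map; apply: eq_sorted => a b /=.
  by rewrite (inj_eq sigma_inj).
have theta_u p : reduced p -> p != [::] -> theta (root_elt commP p) = root_elt commP' (map sigma p).
  move=> rp p0; have [rA _] := pos_avoid rp p0.
  have := thetaU _ rA; rewrite pi_avoid /= !chamber_rootgrp_avoid ?red_map //; last by case: (p) p0.
  move=> h; have : [set 1%g; root_elt commP' (map sigma p)] (theta (root_elt commP p)).
    by rewrite -h; exists (root_elt commP p) => //; right.
  case=> // /esym; rewrite -(morph1 thetaM) => /theta_inj/esym.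
  by move/(chamber_elt_neq1 rp p0).
exists sigma => // p q rq p0 pq npq.
have q0 : q != [::] by case: p p0 pq npq => // ? ?; case: (q).
have rp := reduced_prefix pq rq.
have -> : map sigma (join p q) = join (map sigma p) (map sigma q).
  by rewrite /join map_drop size_map.
have mpq : prefix (map sigma p) (map sigma q).
  by rewrite prefixE size_map -map_take (inj_eq (inj_map sigma_inj)) -prefixE.
apply/idP/idP.
  move/(chamber_commg_neq1 commP rq p0 pq npq) => ne.
  apply/(chamber_commg_neq1 commP') => //; rewrite ?red_map ?(inj_eq (inj_map sigma_inj)) //.
    by case: (p) p0.
  rewrite -!theta_u // -(morphR thetaM) -(morph1 thetaM) => /theta_inj; exact: ne.
have mp0 : map sigma p != [::] by case: (p) p0.
move/(chamber_commg_neq1 commP'); rewrite red_map (inj_eq (inj_map sigma_inj)).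
move=> /(_ rq mp0 mpq npq) ne; apply/(chamber_commg_neq1 commP) => // e1; apply: ne.
by rewrite -!theta_u // -(morphR thetaM) e1 (morph1 thetaM).
Qed.

End Isomorphism.

(** * The family indexed by predicates on the natural numbers *)

Definition alphabet : finType := option bool.
Definition letter_s : alphabet := Some true.
Definition letter_t : alphabet := None.
Definition letter_r : alphabet := Some false.

Definition long_word n : seq alphabet :=
  [:: letter_s, letter_t & rcons (flatten (nseq n [:: letter_r; letter_t])) letter_r].

(** Index 0, the word str, always carries a commutator and prevents linearizability; index n+1 is
    governed by P n. Bounding n by the size of v loses nothing, as the word of index n has 2n + 3
    letters. *)
Definition comm_of (P : nat -> bool) : pred (seq alphabet) := fun v =>
  [exists n : 'I_(size v), (v == long_word n) && ((n == 0 :> nat) || P n.-1)].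

Lemma size_long_word n : size (long_word n) = (n.*2 + 3)%N.
Proof. by rewrite /= size_rcons; elim: n => //= n ->. Qed.

Lemma long_word_inj : injective long_word.
Proof.
move=> m n /(congr1 size); rewrite !size_long_word => /addIn.
exact: double_inj.
Qed.

Lemma reduced_long_word n : reduced (long_word n).
Proof.
by rewrite /long_word reduced_cons /=; elim: n.
Qed.

Lemma comm_of_long_word P n : comm_of P (long_word n) = (n == 0) || P n.-1.
Proof.
apply/existsP/idP => [[[k /= _] /andP[/eqP/long_word_inj<- //]]|h].
have n_lt : (n < size (long_word n))%N.
  by rewrite size_long_word -addnn -addnA -{1}[n]addn0 ltn_add2l addn3.
by exists (Ordinal n_lt); rewrite eqxx.
Qed.

Lemma comm_ofP P : admissible letter_t (comm_of P).
Proof.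
move=> v; case/existsP=> -[n /= _] /andP[/eqP-> _].
by exists letter_s, (flatten (nseq n [:: letter_r; letter_t])), letter_r.
Qed.

(** Cantor's diagonal argument along an injection h: the predicate d differs from each g at h g,
    hence from itself at h d. *)
Lemma uncountable_pred : ~ countable [set: nat -> bool].
Proof.
move/countable_injP => [h hinj].
pose d n := `[< exists g : nat -> bool, h g = n /\ ~~ g n >].
have [dd|dd] := boolP (d (h d)).
  have /asboolP[g [gd ngd]] := dd.
  have e : g = d by apply: hinj; rewrite ?in_setT.
  by rewrite e dd in ngd.
by move/asboolP: (dd); apply; exists d.
Qed.

Theorem theorem1 (R : realType) :
  exists (I : Type) (D : I -> rgd_system),
    [/\ ~ countable [set: I],
        forall i, ~ linearizable R (D i)
      & forall i j, rgd_isomorphic (D i) (D j) -> i = j].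
Proof.
exists (nat -> bool), (fun P => chamber_system (@comm_ofP P)); split.
- exact: uncountable_pred.
- by move=> P; apply: (@chamber_not_linearizable _ _ _ _ R letter_s letter_r) => //; exact: (comm_of_long_word P 0).
move=> P Q /chamber_iso_comm[sigma _ iso].
have {}iso n : comm_of P (long_word n) = comm_of Q (map sigma (long_word n)).
  exact: (iso [:: letter_s] (long_word n) (reduced_long_word n) isT isT isT).
(* The word str carries a commutator in every system and is the only long word with three letters,
   so sigma fixes its letters. *)
have sigma_id : sigma =1 id.
  have /esym := iso 0%N; rewrite comm_of_long_word => /existsP[[n /= _] /andP[/eqP e _]].
  case: n e => [[es et er] [[]|] //|n /(congr1 size)].
  by rewrite size_long_word addnC.
(* The value P n is encoded at index n+1. *)
apply/funext => n; have := iso n.+1.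
by rewrite (eq_map sigma_id) map_id !comm_of_long_word.
Qed.
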